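(* Let $n\ge 2$, let $G$ be a domain in $\mathbb R^n$, let $F\in C^n(G)$ be a real-valued function, and let $x_0\in G$. Then $F$ is an $\mathbf L$-function for $x_0$ if and only if $x_0$ is a quasi-isolated point of $F$.
   Context: A domain is a nonempty connected open set; $\rho$ is the Euclidean metric and $\operatorname{diam}$ the corresponding diameter. Quasi-isolated point: $y\in G$ is quasi-isolated for a continuous function $F:G\to\mathbb R$ if $\{y\}$ is a connected component of the level set $F^{-1}(F(y))$. Hypersurface: a connected closed hypersurface in $\mathbb R^n$ is a connected smooth compact $(n-1)$-dimensional submanifold of $\mathbb R^n$ with empty boundary. Such an $H$ bounds a point $p$ if $p\notin H$ and every path from $p$ to any point $x\in\mathbb R^n$ with $\rho(p,x)>\operatorname{diam}(H)$ intersects $H$. Regular value: $a$ is a regular value of $F$ if $dF\neq0$ at every point of $F^{-1}(a)$. $\mathbf L$-function: a $C^r$-smooth function $F:G\to\mathbb R$ is an $\mathbf L$-function for $y\in G$ if there is a sequence $(a_i)$ of regular values of $F$ such that (i) $a_i\to F(y)$ as $i\to\infty$; (ii) for each $i$ there is a connected component $H_i$ of $F^{-1}(a_i)$ which is a smooth (connected closed) hypersurface bounding $y$; (iii) $\operatorname{diam}(H_i)\to0$ as $i\to\infty$. (Here smoothness of the hypersurfaces is that provided by the class of $F$.) *)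

(* Defs.v *)
From HB Require Import structures.
From mathcomp Require Export all_boot all_order all_algebra.
From mathcomp Require Export all_classical all_reals all_analysis.
Export Order.TTheory GRing.Theory Num.Theory.
Export numFieldNormedType.Exports.

Set Implicit Arguments.
Unset Strict Implicit.
Unset Printing Implicit Defensive.

#[global] Open Scope classical_set_scope.
#[global] Open Scope ring_scope.

(* Functions on a subset of R^n are total functions on 'rV[R]_n.  Every notion
   below depends only on the values of F on the open set G under consideration:
   level sets are intersected with G, and limits, derivatives and differentials
   are only taken at points of G. *)

Definition is_domain (R : realType) (n : nat) (G : set 'rV[R]_n) : Prop :=
  [/\ G !=set0, open G & connected G].

(* The library norm on 'rV[R]_n is the sup norm (same topology as the Euclidean
   one), so the Euclidean metric has to be introduced. *)
Definition edist (R : realType) (n : nat) (x y : 'rV[R]_n) : R :=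
  Num.sqrt (\sum_(i < n) (x ord0 i - y ord0 i) ^+ 2).

(* Only used for compact sets; on an unbounded set [sup] is a default value. *)
Definition diam (R : realType) (n : nat) (A : set 'rV[R]_n) : R :=
  sup [set edist x y | x in A & y in A].

(* f is of class C^k on the open set U: all partial derivatives of order <= k
   exist and are continuous at every point of U. *)
Fixpoint class_C (R : realType) (n k : nat) (U : set 'rV[R]_n)
    (f : 'rV[R]_n -> R) : Prop :=
  (forall x, U x -> {for x, continuous f}) /\
  if k is k'.+1 then
    forall i : 'I_n,
      (forall x, U x -> derivable f x (delta_mx ord0 i)) /\
      class_C k' U ('D_(delta_mx ord0 i) f)
  else True.

Definition class_C_map (R : realType) (n m k : nat) (U : set 'rV[R]_n)
    (f : 'rV[R]_n -> 'rV[R]_m) : Prop :=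
  forall j : 'I_m, class_C k U (fun x => f x ord0 j).

(* phi : U -> V is a C^r-diffeomorphism between open sets, with inverse psi. *)
Definition diffeo (R : realType) (n r : nat) (U V : set 'rV[R]_n)
    (phi psi : 'rV[R]_n -> 'rV[R]_n) : Prop :=
  [/\ open U, open V, phi @` U = V & {in U, cancel phi psi}] /\
  class_C_map r U phi /\ class_C_map r V psi.

(* R^k x {0} inside R^n *)
Definition coord_subspace (R : realType) (n k : nat) : set 'rV[R]_n :=
  [set x | forall i : 'I_n, (k <= i)%N -> x ord0 i = 0].

(* k-dimensional C^r submanifolds of R^n without boundary, by slice charts *)
Definition submanifold (R : realType) (n r k : nat) (H : set 'rV[R]_n) : Prop :=
  forall p, H p -> exists (U V : set 'rV[R]_n) (phi psi : 'rV[R]_n -> 'rV[R]_n),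
    [/\ U p, diffeo r U V phi psi
      & phi @` (H `&` U) = V `&` coord_subspace k].

Definition closed_hypersurface (R : realType) (n r : nat)
    (H : set 'rV[R]_n) : Prop :=
  [/\ connected H, compact H & submanifold r n.-1 H].

Definition bounds (R : realType) (n : nat) (H : set 'rV[R]_n)
    (p : 'rV[R]_n) : Prop :=
  ~ H p /\
  forall (x : 'rV[R]_n) (gamma : R -> 'rV[R]_n),
    diam H < edist p x ->
    {within `[0, 1], continuous gamma} -> gamma 0 = p -> gamma 1 = x ->
    exists2 t : R, t \in `[0, 1] & H (gamma t).

Definition level_set (R : realType) (n : nat) (G : set 'rV[R]_n)
    (F : 'rV[R]_n -> R) (a : R) : set 'rV[R]_n :=
  G `&` F @^-1` [set a].

Definition is_component (T : topologicalType) (A C : set T) : Prop :=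
  exists2 x, A x & C = connected_component A x.

Definition quasi_isolated (R : realType) (n : nat) (G : set 'rV[R]_n)
    (F : 'rV[R]_n -> R) (y : 'rV[R]_n) : Prop :=
  is_component (level_set G F (F y)) [set y].

Definition regular_value (R : realType) (n : nat) (G : set 'rV[R]_n)
    (F : 'rV[R]_n -> R) (a : R) : Prop :=
  forall x, level_set G F a x -> 'd F x <> 0 :> ('rV[R]_n -> R).

Definition L_function (R : realType) (n r : nat) (G : set 'rV[R]_n)
    (F : 'rV[R]_n -> R) (y : 'rV[R]_n) : Prop :=
  class_C r G F /\
  exists (a : nat -> R) (H : nat -> set 'rV[R]_n),
    [/\ forall i, regular_value G F (a i),
        a @ \oo --> F y,
        forall i, [/\ is_component (level_set G F (a i)) (H i),
                      closed_hypersurface r (H i) & bounds (H i) y]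
      & (fun i => diam (H i)) @ \oo --> (0 : R)].

(* Main.v *)
From HB Require Import structures.
Require Import Defs.
From mathcomp Require Import perm ring lra.

(* Necessity only uses that a connected set avoiding a closed set K lies in one
   path component of the complement of K.

   For sufficiency, let c = F x0. If x0 is quasi-isolated, the components of x0 in
   {|F - c| <= d} shrink to x0 as d tends to 0, since a decreasing intersection of
   compact connected sets is connected. By Sard's theorem there are arbitrarily
   small t such that both c + t and c - t are regular values. The boundary of the
   component of x0 in {|F - c| < t} separates x0 from infinity, and splits into the
   disjoint compact pieces where F = c + t and F = c - t. By Janiszewski's theorem
   one of them separates, and a minimal separating closed subset of that piece is
   connected; the level component containing it is the desired hypersurface.

   Sard's theorem is needed in its sharp form, for functions of class C^n on R^n.
   Near a critical point where all derivatives of the gradient vanish one gains an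
   order of flatness; near the others the critical set lies in a hypersurface of
   maximal smoothness, which is straightened. The induction keeps track of
   estimates along curves only, so that smoothness lost by f itself under the
   successive changes of coordinates is irrelevant. *)

Set Implicit Arguments.
Unset Strict Implicit.
Unset Printing Implicit Defensive.

(** * Bisection of cubes *)

Section Bisection.
Context {R : realType} {n : nat}.
Implicit Types (x y z p a b : 'rV[R]_n).

(** Janiszewski's theorem comes down to the triviality of a double cover of a cube, and Sard's
    theorem to a bound on the measure of an image. Both are local assertions that pass from two
    halves of a box to the box itself, so that one bisection principle serves for both, in place of
    homology and of covering lemmas. The values c + t and c - t have to be regular at the same time
    because nothing tells in advance on which of the two levels the separating piece will lie. All
    charts replace a single coordinate by the value of a function. The inverse function theorem is
    then a matter of monotonicity along lines, and the other coordinates are left alone, which is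
    what makes the induction on the number of coordinates in Sard's theorem work. *)

Lemma coord_le_norm x i : `|x ord0 i| <= `|x|.
Proof.
rewrite [leRHS]/Num.Def.normr/= mx_normrE.
exact: (le_bigmax _ (fun ij => `|x ij.1 ij.2|) (ord0, i)).
Qed.

Lemma norm_le_coord x (e : R) : 0 <= e -> (forall i, `|x ord0 i| <= e) -> `|x| <= e.
Proof.
move=> e0 H; rewrite [leLHS]/Num.Def.normr/= mx_normrE.
by apply: bigmax_le => // -[i j] _ /=; rewrite ord1.
Qed.

Lemma norm_lt_coord x (e : R) : 0 < e -> (forall i, `|x ord0 i| < e) -> `|x| < e.
Proof.
move=> e0 H; rewrite [ltLHS]/Num.Def.normr/= mx_normrE.
by apply: bigmax_lt => // -[i j] _ /=; rewrite ord1.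
Qed.

Lemma open_normP (U : set 'rV[R]_n) : open U <->
  forall p, U p -> exists2 e : R, 0 < e & forall y, `|y - p| < e -> U y.
Proof.
rewrite openE; split=> H p Up.
  have /nbhs_ballP[e /= e0 He] := H p Up.
  by exists e => // y yp; apply: He; rewrite -ball_normE /= distrC.
have [e e0 He] := H p Up; apply/nbhs_ballP; exists e => //= y.
by rewrite -ball_normE /= distrC; exact: He.
Qed.

Definition row_upd x (j : 'I_n) (t : R) : 'rV[R]_n :=
  \row_i (if i == j then t else x ord0 i).

Definition box a b : set 'rV[R]_n :=
  [set x | forall i, a ord0 i <= x ord0 i <= b ord0 i].

Variable P : 'rV[R]_n -> 'rV[R]_n -> Prop.
Hypothesis glue : forall a b j, (forall i, a ord0 i < b ord0 i) ->
  P a (row_upd b j ((a ord0 j + b ord0 j) / 2)) ->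
  P (row_upd a j ((a ord0 j + b ord0 j) / 2)) b -> P a b.

(** By [glue], one half of a box on which [P] fails is again such a box; cutting across each
    coordinate in turn yields a cube of half the side. *)
Lemma halve_cube a (t : R) : 0 < t -> ~ P a (a + const_mx t) ->
  exists a', [/\ ~ P a' (a' + const_mx (t / 2)),
    (forall i, a ord0 i <= a' ord0 i) &
    (forall i, a' ord0 i + t / 2 <= a ord0 i + t)].
Proof.
move=> t0 nP.
have H m : (m <= n)%N -> exists a', [/\
    ~ P a' (a' + \row_(i < n) (if (i < m)%N then t / 2 else t)),
    (forall i, a ord0 i <= a' ord0 i) &
    (forall i : 'I_n, a' ord0 i + (if (i < m)%N then t / 2 else t) <= a ord0 i + t)].
  elim: m => [_|m IH mn].
    exists a; split => //; contra: nP => /=; congr P; congr (_ + _).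
    by apply/rowP => i; rewrite !mxE.
  have [a' [nPa' aa' a'b]] := IH (ltnW mn).
  pose j : 'I_n := Ordinal mn.
  set b' := a' + _ in nPa'.
  have lt i : a' ord0 i < b' ord0 i.
    by rewrite /b' !mxE ltrDl; case: ifP => _; lra.
  have b'j : b' ord0 j = a' ord0 j + t by rewrite /b' !mxE /= ltnn.
  have [nP1|P1] := pselect (P a' (row_upd b' j ((a' ord0 j + b' ord0 j) / 2))); last first.
    exists a'; split => //.
      contra: P1; congr P; apply/rowP => i; rewrite !mxE.
      case: eqP => [->|/eqP ij] /=; first by rewrite ltnn ltnSn; lra.
      by rewrite ltnS leq_eqVlt; move: ij; rewrite -val_eqE /= => /negPf ->.
    move=> i; apply: le_trans (a'b i); rewrite lerD2l.
    by rewrite ltnS leq_eqVlt; case: (ltnP i m) => h; rewrite ?orbT //; case: ifP => _; lra.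
  have [P2|nP2] := pselect (P (row_upd a' j ((a' ord0 j + b' ord0 j) / 2)) b').
    by case: nPa'; exact: (glue _ nP1 P2).
  exists (row_upd a' j ((a' ord0 j + b' ord0 j) / 2)); split.
  - contra: nP2; congr P; apply/rowP => i; rewrite !mxE.
    case: eqP => [->|/eqP ij] /=; first by rewrite ltnn ltnSn; lra.
    by rewrite ltnS leq_eqVlt; move: ij; rewrite -val_eqE /= => /negPf ->.
  - move=> i; rewrite mxE; case: eqP => [->|_] //.
    by apply: (le_trans (aa' j)); rewrite b'j; lra.
  - move=> i; rewrite mxE; case: eqP => [->|/eqP ij].
      by have := a'b j; rewrite ltnn ltnSn b'j; lra.
    apply: le_trans (a'b i); rewrite lerD2l.
    by rewrite ltnS leq_eqVlt; move: ij; rewrite -val_eqE /= => /negPf ->.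
have [a' [h1 h2 h3]] := H n (leqnn n).
exists a'; split => //.
- contra: h1; congr P; congr (_ + _).
  by apply/rowP => i; rewrite !mxE ltn_ord.
- by move=> i; have := h3 i; rewrite ltn_ord.
Qed.

(** Nested cubes on which [P] fails would shrink to a point [p], against the local hypothesis at
    [p]. The size [e] may depend on [p] without any uniformity. *)
Lemma cube_bisection a (s : R) : 0 < s ->
  (forall p, box a (a + const_mx s) p -> exists2 e : R, 0 < e &
    forall a' t, 0 < t < e -> box a' (a' + const_mx t) p ->
      box a' (a' + const_mx t) `<=` box a (a + const_mx s) ->
      P a' (a' + const_mx t)) ->
  P a (a + const_mx s).
Proof.
move=> s0 loc; apply: contrapT => nP.
have /choice[f Hf] : forall at_ : 'rV[R]_n * R, exists a', 0 < at_.2 ->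
    ~ P at_.1 (at_.1 + const_mx at_.2) ->
    [/\ ~ P a' (a' + const_mx (at_.2 / 2)),
    (forall i, at_.1 ord0 i <= a' ord0 i) &
    (forall i, a' ord0 i + at_.2 / 2 <= at_.1 ord0 i + at_.2)].
  move=> [a' t] /=; have [t0|] := pselect (0 < t); last by exists a'.
  have [h|] := pselect (~ P a' (a' + const_mx t)); last by exists a'.
  by have [a'' h'] := halve_cube t0 h; exists a''.
pose t k : R := s / 2 ^+ k.
pose u := fix u k := if k is k'.+1 then f (u k', t k') else a.
have tS k : t k.+1 = t k / 2.
  by rewrite /t exprSr invfM mulrA.
have t0 k : 0 < t k by rewrite /t divr_gt0 // exprn_gt0.
have Pu k : ~ P (u k) (u k + const_mx (t k)).
  elim: k => [|k IH]; first by rewrite /t expr0 divr1.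
  by have [] := Hf (u k, t k) (t0 k) IH; rewrite /= tS.
have u1 k i : u k ord0 i <= u k.+1 ord0 i.
  by have [_ h _] := Hf (u k, t k) (t0 k) (Pu k); exact: h.
have u2 k i : u k.+1 ord0 i + t k.+1 <= u k ord0 i + t k.
  by have [_ _ h] := Hf (u k, t k) (t0 k) (Pu k); rewrite tS; exact: h.
have u1' k l i : u k ord0 i <= u (k + l)%N ord0 i.
  by elim: l => [|l IH]; rewrite ?addn0 // addnS; exact: le_trans (u1 _ _).
have u2' k l i : u (k + l)%N ord0 i + t (k + l)%N <= u k ord0 i + t k.
  by elim: l => [|l IH]; rewrite ?addn0 // addnS; exact: le_trans (u2 _ _) _.
have ub k l i : u l ord0 i <= u k ord0 i + t k.
  apply: (le_trans (u1' l k i)); rewrite addnC.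
  by apply: le_trans (u2' k l i); rewrite lerDl ltW.
pose p : 'rV[R]_n := \row_i sup (range (fun k => u k ord0 i)).
have hs i : has_sup (range (fun k => u k ord0 i)).
  split; first by exists (u 0%N ord0 i); exists 0%N.
  by exists (u 0%N ord0 i + t 0%N) => _ [l _ <-].
have pk k : box (u k) (u k + const_mx (t k)) p.
  move=> i; rewrite !mxE; apply/andP; split.
    by apply: ub_le_sup; [case: (hs i)|exists k].
  by apply: ge_sup; [case: (hs i)|move=> _ [l _ <-]].
have pa : box a (a + const_mx s) p by have := pk 0%N; rewrite /= /t expr0 divr1.
have [e e0 He] := loc p pa.
have [k ke] : exists k, t k < e.
  have [k hk] : exists k : nat, s / e < k%:R.
    by exists (Num.bound (s / e)); apply: archi_boundP; rewrite divr_ge0 ?ltW.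
  exists k; rewrite /t ltr_pdivrMr ?exprn_gt0 // mulrC -ltr_pdivrMr //.
  apply: (lt_trans hk); rewrite -natrX ltr_nat; exact: ltn_expl.
apply: (Pu k); apply: (He _ _ _ (pk k)); first by rewrite t0.
move=> y hy i; have := hy i; rewrite !mxE => /andP[h1 h2].
have := u1' 0%N k i; have := u2' 0%N k i; rewrite add0n /= {2}/t expr0 divr1.
by move=> h3 h4; apply/andP; split; [exact: le_trans h4 h1|exact: le_trans h2 h3].
Qed.

End Bisection.

(** * Connectedness and Janiszewski's theorem *)

Section Connectedness.
Context {T : topologicalType}.
Implicit Types S X Y W : set T.

Lemma connected_closed_split S X Y : connected S -> closed X -> closed Y ->
  S `<=` X `|` Y -> S `&` X `&` Y = set0 -> S `&` X !=set0 -> S `&` Y = set0.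
Proof.
move=> cS cX cY SXY dXY SX0.
suff SX : S `&` X = S by rewrite -SX.
apply: cS => //; last by exists X.
exists (~` Y); first exact: closed_openC.
apply/seteqP; split=> x [Sx h]; split=> //.
  by move=> Yx; have : (S `&` X `&` Y) x by []; rewrite dXY.
by have [|/h] := SXY x Sx.
Qed.

(** The closure condition makes [W] closed as well as open relative to [S]. It serves to trap a
    connected set in an open one by inspecting limit points only. *)
Lemma connected_open_sub S W : connected S -> open W ->
  S `&` closure W `<=` W -> S `&` W !=set0 -> S `<=` W.
Proof.
move=> cS oW SW SW0; apply/setIidPl; apply: cS => //; first by exists W.
exists (closure W); first exact: closed_closure.
apply/seteqP; split=> x [Sx h]; split => //; first exact: subset_closure.
exact: SW.
Qed.

End Connectedness.

Section Convexity.
Context {R : realType} {n : nat}.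
Implicit Types (S : set 'rV[R]_n) (x y z : 'rV[R]_n).

Definition is_convex S :=
  forall x y (t : R), S x -> S y -> 0 <= t <= 1 -> S (x + t *: (y - x)).

Lemma continuous_segment x y : continuous (fun t : R => x + t *: (y - x)).
Proof.
move=> t; apply: cvgD; first exact: cvg_cst.
by apply: cvgZr_tmp; exact: cvg_id.
Qed.

Lemma convex_connected S : is_convex S -> connected S.
Proof.
move=> cS; have [->|/set0P[x Sx]] := eqVneq S set0; first exact: connected0.
pose seg y : set 'rV[R]_n := (fun t : R => x + t *: (y - x)) @` `[0, 1].
have -> : S = \bigcup_(y in S) seg y.
  apply/seteqP; split=> y.
    move=> Sy; exists y => //; exists 1; first by rewrite /= in_itv /= ler01 lexx.
    by rewrite scale1r addrC subrK.
  by move=> [z Sz [t + <-]]; rewrite /= in_itv /= => t01; exact: cS.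
apply: bigcup_connected.
  exists x => z Sz; exists 0; first by rewrite /= in_itv /= ler01 lexx.
  by rewrite scale0r addr0.
move=> y Sy; apply: connected_continuous_connected; first exact: segment_connected.
by apply: continuous_subspaceT; exact: continuous_segment.
Qed.

Lemma box_convex (a b : 'rV[R]_n) : is_convex (box a b).
Proof.
move=> x y t Sx Sy /andP[t0 t1] i; have := Sx i; have := Sy i.
by rewrite !mxE => /andP[h1 h2] /andP[h3 h4]; nra.
Qed.

Lemma ball_convex x (r : R) : is_convex [set y | `|y - x| < r].
Proof.
move=> y z t /= hy hz /andP[t0 t1].
have -> : y + t *: (z - y) - x = (1 - t) *: (y - x) + t *: (z - x).
  by apply/rowP => i; rewrite !mxE; ring.
apply: le_lt_trans (ler_normD _ _) _; rewrite !normrZ !ger0_norm ?subr_ge0 //.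
have [->|tn0] := eqVneq t 0; first by rewrite subr0 mul1r mul0r addr0.
have t0' : 0 < t by rewrite lt_def tn0.
have : t * `|z - x| < t * r by rewrite ltr_pM2l.
have : (1 - t) * `|y - x| <= (1 - t) * r by rewrite ler_wpM2l ?subr_ge0 // ltW.
lra.
Qed.

Lemma component_open (A : set 'rV[R]_n) x : open A -> open (connected_component A x).
Proof.
move=> /open_normP oA; apply/open_normP => p Cp.
have [e e0 He] := oA p (connected_component_sub Cp).
exists e => // y yp; apply: (connected_component_trans Cp).
exists [set y | `|y - p| < e] => //; split; [by rewrite /= subrr normr0|exact: He|].
exact/convex_connected/ball_convex.
Qed.

Lemma closed_norm_ball x (r : R) : closed [set y | `|y - x| <= r].
Proof.
rewrite -openC; apply/open_normP => p /= /negP; rewrite -ltNge => h.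
exists (`|p - x| - r); first by rewrite subr_gt0.
move=> y yp; apply/negP; rewrite -ltNge.
have : `|p - x| <= `|y - p| + `|y - x|.
  by rewrite (distrC y p) -[p - x](subrKA y); exact: ler_normD.
lra.
Qed.

Lemma norm_ball_compact x (r : R) : compact [set y | `|y - x| <= r].
Proof.
apply: bounded_closed_compact; last exact: closed_norm_ball.
exists (`|x| + r); split; first exact: num_real.
move=> M hM y /= hy; apply: le_trans (ltW hM).
by rewrite -[y](subrK x) addrC; apply: le_trans (ler_normD _ _) _; rewrite lerD2l.
Qed.

Lemma continuous_clamp (a b : R) : continuous (fun t : R => Num.max 0 (Num.min a (2 * t - b))).
Proof.
move=> t.
have c1 c : {for t, continuous (fun _ : R => c : R^o)} by exact: cvg_cst.
have c2 : {for t, continuous (fun t : R => 2 * t - b : R^o)}.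
  apply: continuousB; last exact: cvg_cst.
  by apply: continuousM; [exact: cvg_cst|exact: cvg_id].
exact: (continuous_max (c1 0) (continuous_min (c1 a) c2)).
Qed.

(* Paths are prolonged by clamping the parameter, so that they are continuous
   on all of R and no pasting is needed. *)
Lemma connected_path (K S : set 'rV[R]_n) x y : closed K -> connected S ->
  S `&` K = set0 -> S x -> S y ->
  exists gamma : R -> 'rV[R]_n, [/\ continuous gamma, gamma 0 = x, gamma 1 = y &
    forall t, ~ K (gamma t)].
Proof.
move=> cK cS SK Sx Sy.
have oK : open (~` K) by exact: closed_openC.
pose O : set 'rV[R]_n := [set y | exists gamma : R -> 'rV[R]_n,
  [/\ continuous gamma, gamma 0 = x, forall t, 1 <= t -> gamma t = y &
    forall t, ~ K (gamma t)]].
(* Inside a ball missing [K], membership in [O] passes between the centre and any other point both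
   ways: one direction makes [O] open, the other makes it closed relative to [S]. *)
have ext p q (e : R) : (forall z, `|z - p| < e -> (~` K) z) -> `|q - p| < e ->
    O p \/ O q -> O p /\ O q.
  move=> He qp.
  have step u v : (forall t : R, 0 <= t <= 1 -> (~` K) (u + t *: (v - u))) ->
      O u -> O v.
    move=> uv [g [cg g0 g1 gK]].
    (* The first clamp runs through [g] at double speed; the second leaves 0 only when the first has
       reached 1, and then follows the segment. *)
    exists (fun t => g (Num.max 0 (Num.min 1 (2 * t - 0))) +
      Num.max 0 (Num.min 1 (2 * t - 1)) *: (v - u)); split.
    - move=> t; apply: cvgD.
        apply: (@continuous_comp _ _ _ (fun t : R => Num.max 0 (Num.min 1 (2 * t - 0))) g); last exact: cg.
        exact: continuous_clamp.
      by apply: cvgZr_tmp; exact: continuous_clamp.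
    - rewrite mulr0 subrr sub0r min_r // max_l // g0 max_l; first by rewrite scale0r addr0.
      by rewrite ge_min lerN10 orbT.
    - move=> t t1; rewrite min_l; last lra.
      rewrite max_r // g1 // min_l; last lra.
      by rewrite max_r // scale1r addrC subrK.
    - move=> t; have [h|h] := leP (2 * t) 1.
        rewrite [X in X *: _]max_l ?scale0r ?addr0 //; rewrite ge_min; apply/orP; right; lra.
      rewrite (min_l (_ : 1 <= 2 * t - 0)); last by rewrite subr0 ltW.
      rewrite max_r // g1 //; apply: uv; rewrite le_max lexx /= ge_max ler01 /=.
      by rewrite ge_min lexx.
  have pq t : 0 <= t <= 1 -> (~` K) (p + t *: (q - p)).
    move=> /andP[t0 t1]; apply: He; rewrite addrAC subrr add0r normrZ ger0_norm //.
    by apply: le_lt_trans qp; rewrite ler_piMl.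
  have qp' t : 0 <= t <= 1 -> (~` K) (q + t *: (p - q)).
    move=> /andP[t0 t1]; rewrite (_ : _ + _ = p + (1 - t) *: (q - p)).
      by apply: pq; rewrite subr_ge0 t1 lerBlDr lerDl.
    by apply/rowP => i; rewrite !mxE; ring.
  move=> [Op|Oq]; split => //; first exact: (step _ _ pq Op).
  exact: (step _ _ qp' Oq).
have Sxx : O x.
  exists (fun=> x); split => //; first by move=> t; exact: cvg_cst.
  by move=> _ Kx; have : (S `&` K) x by []; rewrite SK.
have SO : S `<=` O.
  apply: connected_open_sub => //.
  - apply/open_normP => p Op; have [g [_ _ g1 gK]] := Op.
    have /((open_normP _).1 oK)[e e0 He] : (~` K) p by move=> Kp; apply: (gK 1); rewrite g1.
    by exists e => // q qp; have [] := ext p q e He qp (or_introl Op).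
  - move=> p [Sp Op].
    have /((open_normP _).1 oK)[e e0 He] : (~` K) p.
      by move=> Kp; have : (S `&` K) p by []; rewrite SK.
    have /Op[q [Oq]] : nbhs p (ball p e) by exact: nbhsx_ballx.
    rewrite -ball_normE /= distrC => qp.
    by have [] := ext p q e He qp (or_intror Oq).
  - by exists x.
have [g [cg g0 g1 gK]] := SO y Sy.
by exists g; split => //; exact: g1.
Qed.

End Convexity.

(** * Triviality of double covers of a cube *)

Section Cocycle.
Context {R : realType} {n : nat}.
Variables A B C D : set 'rV[R]_n.
Hypotheses (cA : closed A) (cB : closed B) (cC : closed C) (cD : closed D).
Hypotheses (AB : A `|` B = setT) (AB_CD : A `&` B `<=` C `|` D)
  (CD : C `&` D = set0).

(* Triviality over Q of the double cover obtained by gluing two copies of A to two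
   copies of B, straight along D and crosswise along C. *)
Definition trivial_on (Q : set 'rV[R]_n) :=
  exists al be : bool -> set 'rV[R]_n,
  [/\ (forall i, closed (al i)) /\ (forall i, closed (be i)),
      A `&` Q = al false `|` al true /\ B `&` Q = be false `|` be true,
      al false `&` al true = set0 /\ be false `&` be true = set0,
      forall i, al i `&` be i `&` C = set0 &
      forall i, al i `&` be (~~ i) `&` D = set0].

(** On the intersection two trivialisations differ by a locally constant element of Z/2, which is
    constant by connectedness. Exchanging the sheets of the second one accordingly makes them
    agree. *)
Lemma trivial_on_glue (Q1 Q2 : set 'rV[R]_n) : connected (Q1 `&` Q2) ->
  trivial_on Q1 -> trivial_on Q2 -> trivial_on (Q1 `|` Q2).
Proof.
move=> cW [a1 [b1 [[ca1 cb1] [A1 B1] [da1 db1] C1 D1]]].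
move=> [a2 [b2 [[ca2 cb2] [A2 B2] [da2 db2] C2 D2]]].
have no (X : set 'rV[R]_n) x : X = set0 -> X x -> False by move=> ->.
have inA1 x : (A `&` Q1) x <-> exists i, a1 i x.
  rewrite A1; split=> [[]|[[]]] h; by [exists false|exists true|right|left].
have inB1 x : (B `&` Q1) x <-> exists i, b1 i x.
  rewrite B1; split=> [[]|[[]]] h; by [exists false|exists true|right|left].
have inA2 x : (A `&` Q2) x <-> exists i, a2 i x.
  rewrite A2; split=> [[]|[[]]] h; by [exists false|exists true|right|left].
have inB2 x : (B `&` Q2) x <-> exists i, b2 i x.
  rewrite B2; split=> [[]|[[]]] h; by [exists false|exists true|right|left].
have ea1 x i j : a1 i x -> a1 j x -> i = j.
  by case: i; case: j => // h1 h2; case: (no _ x da1); split.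
have eb1 x i j : b1 i x -> b1 j x -> i = j.
  by case: i; case: j => // h1 h2; case: (no _ x db1); split.
have ea2 x i j : a2 i x -> a2 j x -> i = j.
  by case: i; case: j => // h1 h2; case: (no _ x da2); split.
have eb2 x i j : b2 i x -> b2 j x -> i = j.
  by case: i; case: j => // h1 h2; case: (no _ x db2); split.
(* [Z s] is the closed set where the two labellings differ by [s], compared over [A] or over [B]. *)
pose Z (s : bool) := (\bigcup_(i in [set: bool]) (a1 i `&` a2 (s (+) i)))
   `|` (\bigcup_(i in [set: bool]) (b1 i `&` b2 (s (+) i))).
have cZ s : closed (Z s).
  have cl (X Y : bool -> set 'rV[R]_n) : (forall i, closed (X i)) ->
      (forall i, closed (Y i)) -> closed (\bigcup_(i in [set: bool]) (X i `&` Y (s (+) i))).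
    move=> cX cY.
    rewrite (_ : \bigcup_(_ in _) _ = (X false `&` Y (s (+) false)) `|` (X true `&` Y (s (+) true))).
      by apply: closedU; apply: closedI.
    apply/seteqP; split=> x.
      by move=> [[] _ h]; [right|left].
    by move=> [] h; [exists false|exists true].
  by apply: closedU; apply: cl.
have ZW s : Z s `<=` Q1 `&` Q2.
  move=> x [] [i _ [h1 h2]]; split.
  - by have [] := (inA1 x).2 (ex_intro _ i h1).
  - by have [] := (inA2 x).2 (ex_intro _ _ h2).
  - by have [] := (inB1 x).2 (ex_intro _ i h1).
  - by have [] := (inB2 x).2 (ex_intro _ _ h2).
have coverZ : Q1 `&` Q2 `<=` Z false `|` Z true.
  move=> x [q1 q2]; have : (A `|` B) x by rewrite AB.
  move=> [Ax|Bx].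
    have [i hi] := (inA1 x).1 (conj Ax q1); have [j hj] := (inA2 x).1 (conj Ax q2).
    case: (eqVneq j i) => [e|ne]; [left|right]; left; exists i => //; split => //.
      by rewrite /= -e.
    by rewrite /= (_ : ~~ i = j) //; case: (i) (j) ne => -[].
  have [i hi] := (inB1 x).1 (conj Bx q1); have [j hj] := (inB2 x).1 (conj Bx q2).
  case: (eqVneq j i) => [e|ne]; [left|right]; right; exists i => //; split => //.
    by rewrite /= -e.
  by rewrite /= (_ : ~~ i = j) //; case: (i) (j) ne => -[].
(* Over a point of both [A] and [B] the two labels of a trivialisation are unequal exactly on [C].
   The rule is the same for both trivialisations, so comparing them over [A] and over [B] gives the
   same element; this is [dZ]. *)
have mixed1 x i j : a1 i x -> b1 j x -> C x <-> i != j.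
  move=> h1 h2; have CDx : (C `|` D) x.
    apply: AB_CD; split; first by have [] := (inA1 x).2 (ex_intro _ i h1).
    by have [] := (inB1 x).2 (ex_intro _ j h2).
  split=> [Cx|ij]; first by apply/eqP => e; subst j; case: (no _ x (C1 i)); split.
  case: CDx => // Dx; case: (no _ x (D1 i)); split => //; split => //.
  by rewrite (_ : ~~ i = j) //; case: (i) (j) ij => -[].
have mixed2 x i j : a2 i x -> b2 j x -> C x <-> i != j.
  move=> h1 h2; have CDx : (C `|` D) x.
    apply: AB_CD; split; first by have [] := (inA2 x).2 (ex_intro _ i h1).
    by have [] := (inB2 x).2 (ex_intro _ j h2).
  split=> [Cx|ij]; first by apply/eqP => e; subst j; case: (no _ x (C2 i)); split.
  case: CDx => // Dx; case: (no _ x (D2 i)); split => //; split => //.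
  by rewrite (_ : ~~ i = j) //; case: (i) (j) ij => -[].
have dZ : Q1 `&` Q2 `&` Z false `&` Z true = set0.
  rewrite -subset0 => x [[q Z0] Z1].
  case: Z0 => -[i _ /= [h1 h2]]; case: Z1 => -[j _ /= [h3 h4]].
  - by have := ea1 _ _ _ h1 h3; have := ea2 _ _ _ h2 h4; case: (i) (j) => -[].
  - have e1 := mixed1 _ _ _ h1 h3; have e2 := mixed2 _ _ _ h2 h4.
    have : i != j <-> i != ~~ j by rewrite -e1 -e2.
    by case: (i) (j) => -[] /= [u v]; try (by have := u isT); by have := v isT.
  - have e1 := mixed1 _ _ _ h3 h1; have e2 := mixed2 _ _ _ h4 h2.
    have : j != i <-> ~~ j != i by rewrite -e1 -e2.
    by case: (i) (j) => -[] /= [u v]; try (by have := u isT); by have := v isT.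
  - by have := eb1 _ _ _ h1 h3; have := eb2 _ _ _ h2 h4; case: (i) (j) => -[].
have [s Zs] : exists s, Z (~~ s) = set0.
  have [Z0|/set0P[x Zx]] := eqVneq (Z false) set0; first by exists true.
  exists false => /=; rewrite -(setIidr (@ZW true)).
  by apply: (connected_closed_split cW (cZ false)) => //; exists x; split => //; exact: ZW Zx.
have ma x i j : a1 i x -> a2 j x -> j = s (+) i.
  move=> h1 h2; apply/eqP; apply: contrapT => /negP ne; apply: (no _ x Zs).
  left; exists i => //; split => //=.
  by rewrite (_ : _ (+) _ = j) //; move: ne; case: (s) (i) (j) => -[] -[].
have mb x i j : b1 i x -> b2 j x -> j = s (+) i.
  move=> h1 h2; apply/eqP; apply: contrapT => /negP ne; apply: (no _ x Zs).
  right; exists i => //; split => //=.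
  by rewrite (_ : _ (+) _ = j) //; move: ne; case: (s) (i) (j) => -[] -[].
exists (fun i => a1 i `|` a2 (s (+) i)), (fun i => b1 i `|` b2 (s (+) i)); split.
- by split=> i; apply: closedU.
- split.
    rewrite setIUr A1 A2; case: (s); rewrite /= [in RHS]setUACA; congr (_ `|` _).
    by rewrite setUC.
  rewrite setIUr B1 B2; case: (s); rewrite /= [in RHS]setUACA; congr (_ `|` _).
  by rewrite setUC.
- split; rewrite -subset0 => x [[] h1 [] h2].
  + by have := ea1 _ _ _ h1 h2.
  + by have := ma _ _ _ h1 h2; case: (s).
  + by have := ma _ _ _ h2 h1; case: (s).
  + by have := ea2 _ _ _ h1 h2; case: (s).
  + by have := eb1 _ _ _ h1 h2.
  + by have := mb _ _ _ h1 h2; case: (s).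
  + by have := mb _ _ _ h2 h1; case: (s).
  + by have := eb2 _ _ _ h1 h2; case: (s).
- move=> i; rewrite -subset0 => x [[[] h1 [] h2] Cx].
  + by have /(_ Cx) := (mixed1 _ _ _ h1 h2).1; rewrite eqxx.
  (* The labels come from different trivialisations. The point also has a label of the first one
     over [B], which [mb] compares with the given one. *)
  + have [_ q1] := (inA1 x).2 (ex_intro _ _ h1).
    have [Bx _] := (inB2 x).2 (ex_intro _ _ h2).
    have [j hj] := (inB1 x).1 (conj Bx q1).
    have := (mixed1 _ _ _ h1 hj).1 Cx; have := mb _ _ _ hj h2.
    by case: (s) (i) (j) => -[] -[].
  + have [_ q1] := (inB1 x).2 (ex_intro _ _ h2).
    have [Ax _] := (inA2 x).2 (ex_intro _ _ h1).
    have [j hj] := (inA1 x).1 (conj Ax q1).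
    have := (mixed1 _ _ _ hj h2).1 Cx; have := ma _ _ _ hj h1.
    by case: (s) (i) (j) => -[] -[].
  + by have /(_ Cx) := (mixed2 _ _ _ h1 h2).1; rewrite eqxx.
- move=> i; rewrite -subset0 => x [[[] h1 [] h2] Dx];
    have nC : ~ C x by (move=> Cx; apply: (no _ x CD)).
  + by apply: nC; apply/(mixed1 _ _ _ h1 h2); case: (i).
  + have [_ q1] := (inA1 x).2 (ex_intro _ _ h1).
    have [Bx _] := (inB2 x).2 (ex_intro _ _ h2).
    have [j hj] := (inB1 x).1 (conj Bx q1).
    apply: nC; apply/(mixed1 _ _ _ h1 hj); have := mb _ _ _ hj h2.
    by case: (s) (i) (j) => -[] -[].
  + have [_ q1] := (inB1 x).2 (ex_intro _ _ h2).
    have [Ax _] := (inA2 x).2 (ex_intro _ _ h1).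
    have [j hj] := (inA1 x).1 (conj Ax q1).
    apply: nC; apply/(mixed1 _ _ _ hj h2); have := ma _ _ _ hj h1.
    by case: (s) (i) (j) => -[] -[].
  + by apply: nC; apply/(mixed2 _ _ _ h1 h2); case: (s) (i) => -[].
Qed.

(** This is the vanishing of the first cohomology of a cube modulo 2. A small cube misses one of the
    disjoint closed sets [C] and [D]; constant labels work there, opposite on [A] and [B] if it
    misses [D], equal if it misses [C]. The two halves of a box meet in a convex set. *)
Lemma trivial_on_cube (a : 'rV[R]_n) (s : R) : 0 < s ->
  trivial_on (box a (a + const_mx s)).
Proof.
move=> s0; apply: (cube_bisection (P := fun a b => trivial_on (box a b))) => //.
  move=> {}a b j ab; set m := (_ + _) / 2 => t1 t2.
  have hm : a ord0 j <= m <= b ord0 j by have := ab j; rewrite /m => h; lra.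
  rewrite (_ : box a b = box a (row_upd b j m) `|` box (row_upd a j m) b).
    apply: trivial_on_glue => //; apply: convex_connected => x y t [x1 x2] [y1 y2] t01.
    by split; apply: box_convex.
  apply/seteqP; split=> x.
    move=> h; have [xm|xm] := leP (x ord0 j) m; [left|right] => i;
      rewrite mxE; have := h i; case: eqP => [->|_] // /andP[h1 h2].
      by rewrite h1 xm.
    by rewrite h2 ltW.
  by move=> [] h i; have := h i; rewrite mxE; case: eqP => [->|_] // /andP[h1 h2];
    case/andP: hm => ? ?; apply/andP; split => //; apply: le_trans; eassumption.
have cbox x y : closed (box x y : set 'rV[R]_n).
  rewrite (_ : box x y = \bigcap_(i in [set: 'I_n]) ((fun v => v ord0 i) @^-1` `[x ord0 i, y ord0 i])).
    apply: closed_bigI => i _; apply: closed_comp; last exact: interval_closed.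
    by move=> z _; exact: coord_continuous.
  apply/seteqP; split=> v h i; first by move=> _; rewrite /= in_itv /=; exact: h.
  by have := h i I; rewrite /= in_itv.
move=> p _.
have small (K : set 'rV[R]_n) : closed K -> ~ K p -> exists2 e : R, 0 < e &
    forall a' t, 0 < t < e -> box a' (a' + const_mx t) p ->
      box a' (a' + const_mx t) `&` K = set0.
  move=> cK Kp; have /open_normP /(_ p Kp)[e e0 He] := closed_openC cK.
  exists e => // a' t /andP[t0 te] hp; rewrite -subset0 => x [hx]; apply: He.
  apply: norm_lt_coord => // i; have := hx i; have := hp i; rewrite !mxE.
  by rewrite ltr_norml => /andP[? ?] /andP[? ?]; apply/andP; split; lra.
have [Dp|Dp] := pselect (D p); last first.
  have [e e0 He] := small D cD Dp; exists e => // a' t te hp _.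
  set Q := box _ _.
  exists (fun i => if i then set0 else A `&` Q), (fun i => if i then B `&` Q else set0).
  split.
  - by split=> -[]; try exact: closed0; apply: closedI => //; exact: cbox.
  - by rewrite setU0 set0U.
  - by rewrite setI0 set0I.
  - by case; rewrite ?set0I ?setI0 ?set0I.
  - case; rewrite /= ?set0I // -subset0 => x [[_ [_ Qx]] Dx].
    by rewrite -(He a' t te hp).
have Cp : ~ C p by move=> Cp; have : (C `&` D) p by []; rewrite CD.
have [e e0 He] := small C cC Cp; exists e => // a' t te hp _.
set Q := box _ _.
exists (fun i => if i then set0 else A `&` Q), (fun i => if i then set0 else B `&` Q).
split.
- by split=> -[]; try exact: closed0; apply: closedI => //; exact: cbox.
- by rewrite !setU0.
- by rewrite !setI0.
- case; rewrite /= ?set0I // -subset0 => x [[_ [_ Qx]] Cx].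
  by rewrite -(He a' t te hp).
- by case; rewrite /= ?set0I ?setI0 ?set0I.
Qed.

End Cocycle.

Section Janiszewski.
Context {R : realType} {n : nat}.
Implicit Types (K S : set 'rV[R]_n) (p z : 'rV[R]_n).

(** Otherwise let [O] be the component of [p], and glue the union of [O] and [K] to the complement
    of [O], crosswise along [K1] and straight along [K2]. This double cover is trivial over a large
    cube. Following [S1], which misses [K1], the labels of [p] and [z] are equal; following [S2],
    which misses [K2], they are opposite. *)
Lemma janiszewski K1 K2 S1 S2 p z : closed K1 -> closed K2 -> K1 `&` K2 = set0 ->
  connected S1 -> connected S2 -> bounded_set S1 -> bounded_set S2 ->
  S1 `&` K1 = set0 -> S2 `&` K2 = set0 -> S1 p -> S1 z -> S2 p -> S2 z ->
  ~ K1 p -> ~ K2 p -> ~ K1 z -> ~ K2 z ->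
  connected_component (~` (K1 `|` K2)) p z.
Proof.
move=> cK1 cK2 K12 cS1 cS2 [M1 [_ bS1]] [M2 [_ bS2]] S1K S2K S1p S1z S2p S2z K1p K2p K1z K2z.
apply: contrapT => npz.
set K := K1 `|` K2 in npz; have cK : closed K by exact: closedU.
set O := connected_component _ _ in npz.
have Kp : (~` K) p by move=> [].
have Op : O p by exact: connected_component_refl.
have oO : open O by apply: component_open; exact: closed_openC.
have cB : closed (~` O) by exact: open_closedC.
(* A limit point of [O] outside [K] has a ball around it that misses [K] and meets [O], so it
   belongs to [O]. *)
have cA : closed (O `|` K).
  rewrite -openC; apply/open_normP => q /not_orP[Oq Kq].
  have /open_normP /(_ q Kq)[e e0 He] := closed_openC cK.
  exists e => // y yq [Oy|]; last exact: He.
  apply: Oq; apply: (connected_component_trans Oy); apply: connected_component_sym.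
  exists [set y | `|y - q| < e] => //; split; [by rewrite /= subrr normr0|exact: He|].
  exact/convex_connected/ball_convex.
have AB : (O `|` K) `|` ~` O = setT by rewrite setUAC setUv setTU.
have ABK : (O `|` K) `&` ~` O `<=` K1 `|` K2 by move=> x [[]].
pose M := Num.max (`|M1| + 1) (`|M2| + 1).
have M0 : 0 < M by rewrite lt_max; apply/orP; left; rewrite ltr_wpDl.
pose Q : set 'rV[R]_n := box (const_mx (- M)) (const_mx (- M) + const_mx (M + M)).
have inQ x : `|x| <= M -> Q x.
  move=> xM i; rewrite !mxE addrA addNr add0r -ler_norml.
  exact: le_trans (coord_le_norm _ _) xM.
have S1Q : S1 `<=` Q.
  move=> x /bS1 h; apply: inQ; apply: le_trans (h (`|M1| + 1) _) _.
    by rewrite (le_lt_trans (ler_norm _)) // ltrDl.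
  by rewrite /M le_max lexx.
have S2Q : S2 `<=` Q.
  move=> x /bS2 h; apply: inQ; apply: le_trans (h (`|M2| + 1) _) _.
    by rewrite (le_lt_trans (ler_norm _)) // ltrDl.
  by rewrite /M le_max lexx orbT.
have [al [be [[cal cbe] [Ae Be] [dal dbe] HC HD]]] :=
  trivial_on_cube cA cB cK1 cK2 AB ABK K12 (const_mx (- M)) (addr_gt0 M0 M0).
rewrite -/Q in Ae Be.
have no (X : set 'rV[R]_n) x : X = set0 -> X x -> False by move=> ->.
have cov x : Q x -> exists i, al i x \/ be i x.
  move=> Qx; have : (O `|` K `|` ~` O) x by rewrite AB.
  move=> [Ax|Bx].
    by have : (al false `|` al true) x by [rewrite -Ae]; move=> []; [exists false|exists true]; left.
  by have : (be false `|` be true) x by [rewrite -Be]; move=> []; [exists false|exists true]; right.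
have eqal x i j : al i x -> al j x -> i = j.
  by case: i; case: j => // h1 h2; case: (no _ x dal); split.
have eqbe x i j : be i x -> be j x -> i = j.
  by case: i; case: j => // h1 h2; case: (no _ x dbe); split.
have inA x i : al i x -> (O `|` K) x.
  by move=> h; have [] : ((O `|` K) `&` Q) x by rewrite Ae; case: (i) h; [right|left].
have inB x i : be i x -> (~` O) x.
  by move=> h; have [] : ((~` O) `&` Q) x by rewrite Be; case: (i) h; [right|left].
have mixC x i j : al i x -> be j x -> ~ K1 x -> i = j.
  move=> h1 h2 nK; have [//|K2x] := ABK x (conj (inA _ _ h1) (inB _ _ h2)).
  apply/eqP; apply: contrapT => /negP ij; apply: (no _ x (HD i)); split => //; split => //.
  by rewrite (_ : ~~ i = j) //; case: (i) (j) ij => -[].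
have mixD x i j : al i x -> be j x -> ~ K2 x -> i = ~~ j.
  move=> h1 h2 nK; have [K1x|//] := ABK x (conj (inA _ _ h1) (inB _ _ h2)).
  case: (eqVneq i j) => [e|]; last by case: (i) (j) => -[].
  by subst j; case: (no _ x (HC i)).
(* Each endpoint has labels of one kind only: [p] is not in the complement of [O], and [z] is
   neither in [O] nor in [K]. *)
have [i0 hi0] : exists i, al i p.
  have [i []] := cov p (S1Q _ S1p); first by exists i.
  by move=> /inB.
have [j0 hj0] : exists j, be j z.
  have [j []] := cov z (S1Q _ S1z); last by exists j.
  by move=> /inA [//|[]].
have e1 : i0 = j0.
  apply/eqP; apply: contrapT => /negP ij.
  apply: (no (S1 `&` (al (~~ i0) `|` be (~~ i0))) z).
    apply: (connected_closed_split (X := al i0 `|` be i0) cS1) => //.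
    - exact: closedU.
    - exact: closedU.
    - by move=> x /S1Q/cov[i []] h; case: (eqVneq i i0) => [<-|ne]; [left; left|right; left|left; right|right; right] => //;
        rewrite (_ : ~~ i0 = i) //; case: (i) (i0) ne => -[].
    - rewrite -subset0 => x [[S1x u] v].
      have nK : ~ K1 x by move=> ?; case: (no _ x S1K).
      case: u => u; case: v => v.
      + by have := eqal _ _ _ u v; case: (i0).
      + by have := mixC _ _ _ u v nK; case: (i0).
      + by have := mixC _ _ _ v u nK; case: (i0).
      + by have := eqbe _ _ _ u v; case: (i0).
    - by exists p; split => //; left.
  split => //; right; rewrite (_ : ~~ i0 = j0) //; by case: (i0) (j0) ij => -[].
(* Along [S2] every crossing between [A] and [B] exchanges the labels, so [i0] over [A] goes with
   its opposite over [B]. *)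
apply: (no (S2 `&` (al (~~ i0) `|` be i0)) z); last first.
  by split => //; right; rewrite e1.
apply: (connected_closed_split (X := al i0 `|` be (~~ i0)) cS2) => //.
- exact: closedU.
- exact: closedU.
- by move=> x /S2Q/cov[i []] h; case: (eqVneq i i0) => [<-|ne]; [left; left|right; left|right; right|left; right] => //;
    rewrite (_ : ~~ i0 = i) //; case: (i) (i0) ne => -[].
- rewrite -subset0 => x [[S2x u] v].
  have nK : ~ K2 x by move=> ?; case: (no _ x S2K).
  case: u => u; case: v => v.
  + by have := eqal _ _ _ u v; case: (i0).
  + by have := mixD _ _ _ u v nK; case: (i0).
  + by have := mixD _ _ _ v u nK; case: (i0).
  + by have := eqbe _ _ _ u v; case: (i0).
- by exists p; split => //; left.
Qed.

End Janiszewski.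

(** * Functions of class C^k *)

Lemma near_eq_continuous (T U : topologicalType) (f g : T -> U) x :
  (\near x, f x = g x) -> {for x, continuous f} -> {for x, continuous g}.
Proof.
move=> E cf; rewrite /prop_for /continuous_at -(nbhs_singleton E).
by apply: cvg_trans cf; exact: (fun P => @near_eq_cvg _ _ (nbhs x) _ _ _ E P).
Qed.

Lemma continuous_normP (R : realType) (V W : normedModType R) (f : V -> W) x :
  {for x, continuous f} <-> forall e : R, 0 < e -> exists2 d : R, 0 < d &
    forall y, `|y - x| < d -> `|f y - f x| < e.
Proof.
split=> [cf e e0|H].
  have /cvgrPdist_lt h := cf.
  have /nbhs_ballP[d /= d0 Hd] := h _ e0; exists d => // y yx.
  by rewrite distrC; apply: Hd; rewrite -ball_normE /= distrC.
apply/cvgrPdist_lt => e /H[d d0 Hd]; apply/nbhs_ballP; exists d => // y.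
by rewrite -ball_normE /= distrC => /Hd; rewrite distrC.
Qed.

Lemma rV_continuous (R : realType) (n : nat) (T : topologicalType)
    (psi : T -> 'rV[R]_n) z :
  (forall i, {for z, continuous (fun x => psi x ord0 i)}) -> {for z, continuous psi}.
Proof.
move=> cpsi; apply/cvgrPdist_lt => e e0; near=> w.
suff : forall i, `|psi z ord0 i - psi w ord0 i| < e.
  by move=> h; apply: norm_lt_coord => // i; rewrite !mxE.
near: w; apply: filter_forall => i; have /cvgrPdist_lt := cpsi i; exact.
Unshelve. all: by end_near. Qed.

Section Differential.
Context {R : realType} {n : nat}.
Implicit Types (f g : 'rV[R]_n -> R) (x y p v : 'rV[R]_n) (U V : set 'rV[R]_n).

Local Notation ee i := (@delta_mx R 1 n ord0 i).

Lemma is_derive_line {W : normedModType R} (f : 'rV[R]_n -> W) p v (t : R) :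
  derivable f (p + t *: v) v ->
  is_derive t 1 (fun s : R => f (p + s *: v)) ('D_v f (p + t *: v)).
Proof.
have E : (fun h : R => h^-1 *: (f (p + (h *: 1 + t) *: v) - f (p + t *: v))) =
    (fun h : R => h^-1 *: (f (h *: v + (p + t *: v)) - f (p + t *: v))).
  apply/funext => h; congr (_ *: (f _ - _)).
  by rewrite scalerDl [h *: 1](mulr1 h) addrCA.
by move=> d; apply: DeriveDef; rewrite /derivable /derive /= ?E.
Qed.

Lemma line_mvt f p v (h : R) :
  (forall t : R, `|t| <= `|h| -> derivable f (p + t *: v) v) ->
  exists2 t : R, `|t| <= `|h| & f (p + h *: v) - f p = h * 'D_v f (p + t *: v).
Proof.
move=> df; pose phi s := f (p + s *: v).
have dphi (t : R) : `|t| <= `|h| -> is_derive t 1 phi ('D_v f (p + t *: v)).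
  by move=> th; apply: is_derive_line; exact: df.
have cphi (t : R) : `|t| <= `|h| -> {for t, continuous phi}.
  move=> /dphi[d _]; apply: differentiable_continuous; exact/derivable1_diffP.
have p0 : phi 0 = f p by rewrite /phi scale0r addr0.
have [h0|h0] := leP 0 h.
  have [||t t01 e] := @MVT_segment R phi (fun t => 'D_v f (p + t *: v)) 0 h h0.
  - move=> t; rewrite in_itv /= => /andP[t0 t1]; apply: dphi.
    by rewrite (ger0_norm (ltW t0)) (ger0_norm h0) ltW.
  - apply: continuous_in_subspaceT => t; rewrite inE /= in_itv /= => /andP[t0 t1].
    by apply: cphi; rewrite !ger0_norm.
  - move: t01; rewrite in_itv /= => /andP[t0 t1].
    by exists t; [rewrite !ger0_norm|rewrite -p0 [LHS]e subr0 mulrC].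
have [||t t01 e] := @MVT_segment R phi (fun t => 'D_v f (p + t *: v)) h 0 (ltW h0).
- move=> t; rewrite in_itv /= => /andP[t0 t1]; apply: dphi.
  by rewrite (ltr0_norm t1) (ltr0_norm h0) lerN2 ltW.
- apply: continuous_in_subspaceT => t; rewrite inE /= in_itv /= => /andP[t0 t1].
  by apply: cphi; rewrite ler0_norm // ltr0_norm // lerN2.
- move: t01; rewrite in_itv /= => /andP[t0 t1].
  exists t; first by rewrite ler0_norm // ltr0_norm // lerN2.
  by rewrite -p0 -[LHS]opprB [X in - X]e sub0r mulrN opprK mulrC.
Qed.

Lemma class_C_continuous k U f x : class_C k U f -> U x -> {for x, continuous f}.
Proof. by case: k => [|k] [h _]; exact: h. Qed.

Lemma class_CS k U f : class_C k.+1 U f -> class_C k U f.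
Proof.
elim: k f => [|k IH] f [cf df]; split => // i.
by have [d1 d2] := df i; split => //; exact: IH.
Qed.

Lemma class_C_le k m U f : (k <= m)%N -> class_C m U f -> class_C k U f.
Proof.
move=> /subnK <-; elim: (m - k)%N => [//|d IH].
by rewrite addSn => /class_CS.
Qed.

Lemma class_C_sub k U V f : V `<=` U -> class_C k U f -> class_C k V f.
Proof.
move=> VU; elim: k f => [|k IH] f [cf df]; split => //.
- by move=> x /VU; exact: cf.
- by move=> x /VU; exact: cf.
- move=> i; have [d1 d2] := df i; split; first by move=> x /VU; exact: d1.
  exact: IH.
Qed.

Lemma class_C_eq k U f g : open U -> (forall x, U x -> f x = g x) ->
  class_C k U f -> class_C k U g.
Proof.
move=> oU; elim: k f g => [|k IH] f g fg [cf df].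
  split => // x Ux; have E : \near x, f x = g x.
    by apply: filterS (open_nbhs_nbhs (conj oU Ux)) => y; exact: fg.
  exact: near_eq_continuous E (cf x Ux).
have E x : U x -> \near x, f x = g x.
  by move=> Ux; apply: filterS (open_nbhs_nbhs (conj oU Ux)) => y; exact: fg.
split.
  move=> x Ux.
  exact: near_eq_continuous (E x Ux) (cf x Ux).
move=> i; have [d1 d2] := df i; split.
  by move=> x Ux; apply: near_eq_derivable (E x Ux) (d1 x Ux).
apply: IH d2 => x Ux; exact: (near_eq_derive _ (E x Ux)).
Qed.

(* The mean value theorem is applied along each edge of the path from x to x + h
   that switches on the coordinates of h one after the other. *)
Lemma class_C_differentiable k U f x : open U -> class_C k.+1 U f -> U x ->
  differentiable f x.
Proof.
move=> oU Cf Ux.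
have [cf df] : class_C 1 U f by exact: class_C_le Cf.
pose d (h : 'rV[R]_n) : R := \sum_(i < n) h ord0 i *: 'D_(ee i) f x.
have lin_d : linear d.
  move=> a u w; rewrite /d scaler_sumr -big_split /=; apply: eq_bigr => i _.
  by rewrite !mxE scalerDl scalerA.
pose dM := GRing.isLinear.Build _ _ _ _ _ lin_d.
pose dL : {linear _ -> _} := HB.pack d dM.
have cd : continuous dL.
  apply: (continuous_big add_continuous) => i _ y.
  by apply: (@cvgZr_tmp _ _ _ (nbhs y)); exact: coord_continuous.
have ex : f \o shift x = cst (f x) + (dL : 'rV[R]_n -> R) +o_ (0 : 'rV[R]_n) id.
  apply/eqaddoP => _/posnumP[e].
  have [r r0 Hr] : exists2 r : R, 0 < r & forall y, `|y - x| < r ->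
      U y /\ forall i, `|'D_(ee i) f y - 'D_(ee i) f x| <= e%:num / (n%:R + 1).
    have : \forall y \near x, U y /\
       forall i, `|'D_(ee i) f y - 'D_(ee i) f x| <= e%:num / (n%:R + 1).
      near=> y; split; first by near: y; exact: open_nbhs_nbhs.
      near: y; apply: filter_forall => i.
      have [_ [ci _]] := df i.
      have /cvgrPdist_le h := ci x Ux.
      have e0 : 0 < e%:num / (n%:R + 1) by rewrite divr_gt0 // ltr_wpDl.
      by apply: filterS (h _ e0) => y; rewrite distrC.
    move=> /nbhs_ballP[r /= r0 Hr]; exists r => // y yx; apply: Hr.
    by rewrite -ball_normE /= distrC.
  near=> h.
  have hr : `|h| < r.
    by near: h; apply/nbhs_ballP; exists r => //= y; rewrite -ball_normE /= sub0r normrN.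
  rewrite /= !fctE /=.
  pose u (m : nat) : 'rV[R]_n := x + \row_i (if (i < m)%N then h ord0 i else 0).
  have u0 : u 0%N = x by rewrite /u; apply/rowP => i; rewrite !mxE ltn0 addr0.
  have un : u n = h + x.
    by rewrite /u; apply/rowP => i; rewrite !mxE ltn_ord addrC.
  have step (i : 'I_n) : `|f (u i.+1) - f (u i) - h ord0 i *: 'D_(ee i) f x| <=
      e%:num / (n%:R + 1) * `|h|.
    have uS : u i.+1 = u i + h ord0 i *: (ee i).
      rewrite /u -addrA; congr (_ + _); apply/rowP => j; rewrite !mxE /= ltnS leq_eqVlt.
      have [->|ji] := eqVneq j i; first by rewrite eqxx ltnn /= mulr1 add0r.
      by move: (ji); rewrite -val_eqE => /negPf -> /=; rewrite mulr0 addr0.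
    have near_u t : `|t| <= `|h ord0 i| -> `|u i + t *: (ee i) - x| < r.
      move=> th; apply: le_lt_trans hr; apply: norm_le_coord => // j.
      rewrite !mxE /=; have [->|ji] := eqVneq j i.
        rewrite ltnn addr0 mulr1 addrAC subrr add0r.
        by apply: le_trans th (coord_le_norm _ _).
      rewrite mulr0 addr0 addrAC subrr add0r; case: ifP => _; first exact: coord_le_norm.
      by rewrite normr0.
    have [t th e1] := @line_mvt f (u i) (ee i) (h ord0 i)
      (fun t th => (df i).1 _ (Hr _ (near_u t th)).1).
    rewrite uS e1 -[_ *: 'D_ _ f x]/(_ * _) -mulrBr normrM mulrC.
    apply: ler_pM => //; last exact: coord_le_norm.
    exact: (Hr _ (near_u t th)).2.
  have -> : f (h + x) - (f x + d h) =
      \sum_(i < n) (f (u i.+1) - f (u i) - h ord0 i *: 'D_(ee i) f x).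
    rewrite sumrB -(big_mkord xpredT (fun i => f (u i.+1) - f (u i))).
    by rewrite telescope_sumr // un u0 opprD addrA.
  apply: le_trans (ler_norm_sum _ _ _) _.
  apply: le_trans (ler_sum _ (fun i _ => step i)) _.
  rewrite sumr_const card_ord -[leLHS]mulr_natl mulrA ler_wpM2r //.
  rewrite mulrA ler_pdivrMr ?ltr_wpDl // mulrC.
  by rewrite ler_wpM2l // lerDl.
have dE := diff_unique cd ex.
by apply/diff_locallyP; rewrite dE.
Unshelve. all: by end_near. Qed.

Lemma deriv_curve f (g : R -> 'rV[R]_n) (t : R) (dg : 'rV[R]_n) :
  differentiable f (g t) -> is_derive t 1 g dg ->
  is_derive t 1 (f \o g) (\sum_(i < n) dg ord0 i * 'D_(ee i) f (g t)).
Proof.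
move=> df [dg1 dg2].
have dg' : differentiable g t by exact/derivable1_diffP.
have dfg : differentiable (f \o g) t by exact: differentiable_comp.
apply: DeriveDef; first exact/derivable1_diffP.
have e : 'd g t 1 = dg by rewrite -deriveE.
rewrite deriveE // diff_comp //= e [in LHS](row_sum_delta dg).
rewrite linear_sum; apply: eq_bigr => i _.
by rewrite linearZ /= -deriveE.
Qed.

Lemma partial_comp m f (psi : 'rV[R]_m -> 'rV[R]_n) (x v : 'rV[R]_m) :
  differentiable f (psi x) ->
  (forall j, derivable (fun z => psi z ord0 j) x v) ->
  is_derive x v (f \o psi)
    (\sum_(j < n) 'D_v (fun z => psi z ord0 j) x * 'D_(ee j) f (psi x)).
Proof.
move=> df dpsi.
have dp : derivable psi x v.
  by apply/derivable_mxP => i j; rewrite ord1.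
have H (W : normedModType R) (F : 'rV[R]_m -> W) : 'D_v F x = 'D_1 (fun s : R => F (s *: v + x)) 0 /\
    (derivable F x v <-> derivable (fun h : R => F (h *: v + x)) 0 1).
  split; last by apply: derivable1P.
  rewrite /derive /=.
  have -> : (fun h : R => h^-1 *: (F (h *: v + x) - F x)) =
      (fun h : R => h^-1 *: (F ((h *: 1 + 0) *: v + x) - F (0 *: v + x))).
    by apply/funext => h; rewrite addr0 scale0r add0r [h *: 1](mulr1 h).
  by [].
have dc : is_derive (0 : R) 1 (fun s : R => psi (s *: v + x)) ('D_v psi x).
  have [E1 E2] := H 'rV[R]_n psi.
  by apply: DeriveDef; [exact: E2.1|rewrite -E1].
have := @deriv_curve f (fun s : R => psi (s *: v + x)) 0 _ _ dc.
rewrite scale0r add0r => /(_ df)[h1 h2].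
have [E1 E2] := H R (f \o psi).
apply: DeriveDef; first exact: (E2.2 h1).
rewrite E1 [LHS]h2; apply: eq_bigr => j _; congr (_ * _).
by rewrite derive_mx // mxE.
Qed.

End Differential.

Section ClassC.
Context {R : realType} {n : nat}.
Implicit Types (f g : 'rV[R]_n -> R) (x y p v : 'rV[R]_n) (U V : set 'rV[R]_n).

Local Notation ee i := (@delta_mx R 1 n ord0 i).

Lemma class_C_cst k U (c : R) : class_C k U (cst c : 'rV[R]_n -> R).
Proof.
elim: k c => [|k IH] c; split => //; try by move=> x _; exact: cst_continuous.
move=> i; split; first by move=> x _; exact: derivable_cst.
rewrite (_ : 'D_ _ _ = cst 0); first exact: IH.
by apply/funext => x; rewrite derive_cst.
Qed.

Lemma is_derive_coord (j : 'I_n) x v :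
  is_derive x v (fun y : 'rV[R]_n => y ord0 j) (v ord0 j).
Proof.
have d : derivable (@id 'rV[R]_n) x v by exact: derivable_id.
apply: DeriveDef; first by have /derivable_mxP := d; exact.
by have := derive_mx d; rewrite derive_id => /rowP/(_ j); rewrite mxE.
Qed.

Lemma class_C_coord k U j : class_C k U (fun y : 'rV[R]_n => y ord0 j).
Proof.
case: k => [|k]; split => //; try by move=> x _; exact: coord_continuous.
move=> i; split; first by move=> x _; have [] := is_derive_coord j x (ee i).
rewrite (_ : 'D_ _ _ = cst ((ee i) ord0 j)); first exact: class_C_cst.
by apply/funext => x; have [_ ->] := is_derive_coord j x (ee i).
Qed.

Lemma class_CD k U f g : open U -> class_C k U f -> class_C k U g ->
  class_C k U (f \+ g).
Proof.
move=> oU; elim: k f g => [|k IH] f g [cf df] [cg dg]; split => //.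
- by move=> x Ux; apply: continuousD; [exact: cf|exact: cg].
- by move=> x Ux; apply: continuousD; [exact: cf|exact: cg].
move=> i; have [df1 df2] := df i; have [dg1 dg2] := dg i; split.
  by move=> x Ux; apply: derivableD; [exact: df1|exact: dg1].
apply: class_C_eq (IH _ _ df2 dg2) => // x Ux.
by rewrite /= deriveD; [|exact: df1|exact: dg1].
Qed.

Lemma class_CM k U f g : open U -> class_C k U f -> class_C k U g ->
  class_C k U (f \* g).
Proof.
move=> oU; elim: k f g => [|k IH] f g Cf Cg.
  have [cf _] := Cf; have [cg _] := Cg; split => // x Ux.
  by apply: continuousM; [exact: cf|exact: cg].
have Cf' := class_CS Cf; have Cg' := class_CS Cg.
have [cf df] := Cf; have [cg dg] := Cg; split => //.
  by move=> x Ux; apply: continuousM; [exact: cf|exact: cg].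
move=> i; have [df1 df2] := df i; have [dg1 dg2] := dg i; split.
  by move=> x Ux; apply: derivableM; [exact: df1|exact: dg1].
apply: class_C_eq (class_CD oU (IH _ _ Cf' dg2) (IH _ _ Cg' df2)) => // x Ux.
by rewrite /= deriveM; [|exact: df1|exact: dg1].
Qed.

Lemma class_C_sum k U m (F : 'I_m -> 'rV[R]_n -> R) : open U ->
  (forall i, class_C k U (F i)) -> class_C k U (fun x => \sum_i F i x).
Proof.
move=> oU; elim: m F => [|m IH] F CF.
  by under eq_fun do rewrite big_ord0; exact: class_C_cst.
under eq_fun do rewrite big_ord_recr /=.
by apply: class_CD => //; apply: IH.
Qed.

Lemma class_CN k U f : open U -> class_C k U f -> class_C k U (fun x => - f x).
Proof.
move=> oU Cf; apply: class_C_eq (class_CM oU (class_C_cst k U (-1)) Cf) => // x _.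
by rewrite /= mulN1r.
Qed.

Lemma class_CV k U f : open U -> (forall x, U x -> f x != 0) ->
  class_C k U f -> class_C k U (fun x => (f x)^-1).
Proof.
move=> oU f0; elim: k => [|k IH] Cf.
  have [cf _] := Cf; split => // x Ux.
  by apply: continuousV; [exact: f0|exact: cf].
have Cf' := class_CS Cf; have [cf df] := Cf; split => //.
  by move=> x Ux; apply: continuousV; [exact: f0|exact: cf].
move=> i; have [df1 df2] := df i; split.
  by move=> x Ux; apply: derivableV; [exact: f0|exact: df1].
have CI := IH Cf'.
apply: class_C_eq (class_CN oU (class_CM oU (class_CM oU CI CI) df2)) => // x Ux.
rewrite /= deriveV; [|exact: f0|exact: df1].
by rewrite -[_ *: _]/(_ * _) -exprVn expr2 mulNr.
Qed.

End ClassC.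

Section ClassCComp.
Context {R : realType} {n m : nat}.
Implicit Types (U : set 'rV[R]_n).

Local Notation ee i := (@delta_mx R 1 n ord0 i).

Lemma class_C_comp k U (V : set 'rV[R]_m) (f : 'rV[R]_n -> R) (psi : 'rV[R]_m -> 'rV[R]_n) :
  open U -> open V -> (forall z, V z -> U (psi z)) -> class_C k U f ->
  class_C_map k V psi -> class_C k V (f \o psi).
Proof.
move=> oU oV VU; elim: k f => [|k IH] f Cf Cpsi.
  split => // z Vz; apply: continuous_comp; last exact: (Cf.1 _ (VU _ Vz)).
  by apply: rV_continuous => i; exact: (Cpsi i).1.
have Cf' := class_CS Cf; have Cpsi' : class_C_map k V psi.
  by move=> j; apply/class_CS/Cpsi.
have := IH _ Cf' Cpsi' => Cfp.
have dfp (z : 'rV[R]_m) (i : 'I_m) : V z -> is_derive z (delta_mx ord0 i) (f \o psi)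
    (\sum_(j < n) 'D_(delta_mx ord0 i) (fun z => psi z ord0 j) z * 'D_(ee j) f (psi z)).
  move=> Vz; apply: partial_comp; first exact: class_C_differentiable Cf (VU _ Vz).
  by move=> j; have [_ /(_ i)[h _]] := Cpsi j; exact: h.
split; first by move=> z Vz; exact: class_C_continuous Cfp Vz.
move=> i; split; first by move=> z Vz; have [] := dfp z i Vz.
have C (j : 'I_n) : class_C k V (fun z =>
    'D_(delta_mx ord0 i) (fun z => psi z ord0 j) z * 'D_(ee j) f (psi z)).
  have [_ /(_ i)[_ h1]] := Cpsi j; have [_ /(_ j)[_ h2]] := Cf.
  exact: (class_CM oV h1 (IH _ h2 Cpsi')).
apply: class_C_eq (class_C_sum oV C) => // z Vz.
by have [_ ->] := dfp z i Vz.
Qed.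

End ClassCComp.

(** * Straightening a function *)

Section Chart.
Context {R : realType} {n : nat}.
Implicit Types (f g : 'rV[R]_n -> R) (x y z p q v : 'rV[R]_n) (U V : set 'rV[R]_n).

Local Notation ee i := (@delta_mx R 1 n ord0 i).

Lemma class_C_mvt k U f x y : open U -> class_C k.+1 U f ->
  (forall s : R, 0 <= s <= 1 -> U (x + s *: (y - x))) ->
  exists2 s : R, 0 <= s <= 1 & f y - f x =
    \sum_(l < n) (y - x) ord0 l * 'D_(ee l) f (x + s *: (y - x)).
Proof.
move=> oU Cf Uxy; pose phi (s : R) := f (x + s *: (y - x)).
pose dphi (s : R) := \sum_(l < n) (y - x) ord0 l * 'D_(ee l) f (x + s *: (y - x)).
have d (s : R) : 0 <= s <= 1 -> is_derive s 1 phi (dphi s).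
  move=> s01; apply: (deriv_curve (g := fun s : R => x + s *: (y - x))).
    exact: class_C_differentiable Cf (Uxy _ s01).
  have dI : derivable (@id 'rV[R]_n) (x + s *: (y - x)) (y - x) by exact: derivable_id.
  by have := is_derive_line dI; rewrite derive_id.
have [||s s01 e] := @MVT_segment R phi dphi 0 1 ler01.
- by move=> s; rewrite in_itv /= => /andP[s0 s1]; apply: d; rewrite !ltW.
- apply: continuous_in_subspaceT => s; rewrite inE /= in_itv /= => /d[h _].
  by apply: differentiable_continuous; exact/derivable1_diffP.
exists s; first by move: s01; rewrite in_itv.
have e1 : phi 1 = f y by rewrite /phi scale1r addrC subrK.
have e0 : phi 0 = f x by rewrite /phi scale0r addr0.
by rewrite -e1 -e0 [LHS]e subr0 mulr1.
Qed.

Lemma class_C_mvt_coord k U f x (j : 'I_n) (h : R) : open U -> class_C k.+1 U f ->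
  (forall s : R, 0 <= s <= 1 -> U (x + (s * h) *: (ee j))) ->
  exists2 s : R, 0 <= s <= 1 & f (x + h *: (ee j)) - f x =
    h * 'D_(ee j) f (x + (s * h) *: (ee j)).
Proof.
move=> oU Cf Uxh; have E (s : R) : x + s *: (x + h *: (ee j) - x) = x + (s * h) *: (ee j).
  by rewrite addrAC subrr add0r scalerA.
have [s s01 e] := @class_C_mvt k U f x (x + h *: (ee j)) oU Cf
  (fun s s01 => eq_ind_r U (Uxh s s01) (E s)).
exists s => //; rewrite e E (bigD1 j) //= big1 ?addr0.
  by rewrite !mxE !eqxx mulr1 addrAC subrr add0r.
by move=> i ij; rewrite !mxE (negPf ij) mulr0 addr0 subrr mul0r.
Qed.

Lemma norm_scale_delta (j : 'I_n) (t : R) : `|(t *: (ee j) : 'rV[R]_n)| = `|t|.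
Proof.
apply/eqP; rewrite eq_le; apply/andP; split.
  apply: norm_le_coord => // i; rewrite !mxE /=.
  by case: (i == j); rewrite ?mulr1 ?mulr0 ?normr0.
by have := @coord_le_norm R n (t *: (ee j)) j; rewrite !mxE !eqxx mulr1.
Qed.

Section Straightening.
Variables (k : nat) (U : set 'rV[R]_n) (g : 'rV[R]_n -> R) (p : 'rV[R]_n) (j : 'I_n).
Hypotheses (oU : open U) (Cg : class_C k.+1 U g) (Up : U p) (dg : 'D_(ee j) g p != 0).

(** Inverting [phi] is a one-variable problem on each line parallel to axis [j], where [g] is
    strictly monotone near [p]. *)
Let phi x : 'rV[R]_n := row_upd x j (g x).
Let c := 'D_(ee j) g p.

Let B_exists : exists2 r : R, 0 < r & forall x, `|x - p| < r ->
  U x /\ `|'D_(ee j) g x - c| < `|c| / 2.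
Proof.
have [_ /(_ j)[_ C1]] := Cg.
have /cvgrPdist_lt h := class_C_continuous C1 Up.
have c0 : 0 < `|c| / 2 by rewrite divr_gt0 // normr_gt0.
have : \forall x \near p, U x /\ `|'D_(ee j) g x - c| < `|c| / 2.
  near=> x; split; first by near: x; exact: open_nbhs_nbhs.
  by rewrite distrC; near: x; exact: h.
move=> /nbhs_ballP[r /= r0 Hr]; exists r => // x xp; apply: Hr.
by rewrite -ball_normE /= distrC.
Unshelve. all: by end_near. Qed.

Let r := sval (cid2 B_exists).
Let B := [set x | `|x - p| < r].

Let r_gt0 : 0 < r. Proof. by rewrite /r; case: cid2. Qed.

Let BU x : B x -> U x.
Proof. by rewrite /B /r; case: cid2 => r' /= _ h /h[]. Qed.

(** The sign of [c], by which the increasing and the decreasing case are treated together. *)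
Let sg : R := if 0 < c then 1 else -1.

Let B_deriv x : B x -> `|c| / 2 < sg * 'D_(ee j) g x.
Proof.
rewrite /B /r; case: cid2 => r' /= _ h /h[_].
move: dg; rewrite -/c neq_lt /sg => /orP[c0|c0].
  rewrite (ltNge 0 c) (ltW c0) /= (ltr0_norm c0) mulN1r ltr_distl => /andP[]; lra.
rewrite c0 (gtr0_norm c0) mul1r ltr_distl => /andP[]; lra.
Qed.

Let B_open : open B.
Proof.
apply/open_normP => x Bx; exists (r - `|x - p|); first by rewrite subr_gt0.
move=> y yx; rewrite /B /= -(subrKA x); apply: le_lt_trans (ler_normD _ _) _; lra.
Qed.

Let B_mono x (h : R) : 0 < h -> B x -> B (x + h *: (ee j)) ->
  h * (`|c| / 2) < sg * (g (x + h *: (ee j)) - g x).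
Proof.
move=> h0 Bx Bxh.
have Bs (s : R) : 0 <= s <= 1 -> B (x + (s * h) *: (ee j)).
  move=> s01; have := @ball_convex R n p r x (x + h *: (ee j)) s Bx Bxh s01.
  by rewrite addrAC subrr add0r scalerA.
have [s s01 ->] := class_C_mvt_coord B_open (class_C_sub BU Cg) Bs.
by rewrite [ltRHS]mulrCA ltr_pM2l //; exact/B_deriv/Bs.
Qed.

Let phi_inj x y : B x -> B y -> phi x = phi y -> x = y.
Proof.
wlog xy : x y / x ord0 j <= y ord0 j.
  by move=> H; case: (leP (x ord0 j) (y ord0 j)) => [|/ltW] h *; [|symmetry]; exact: H.
move=> Bx By e.
have ei i : i != j -> x ord0 i = y ord0 i.
  by move=> ij; move/rowP/(_ i): e; rewrite !mxE (negPf ij).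
have ey : y = x + (y ord0 j - x ord0 j) *: (ee j).
  apply/rowP => i; rewrite !mxE /=; have [->|ij] := eqVneq i j.
    by rewrite mulr1 addrC subrK.
  by rewrite mulr0 addr0 ei.
have eg : g x = g y by move/rowP/(_ j): e; rewrite !mxE eqxx.
move: xy; rewrite le_eqVlt => /orP[/eqP exy|xy].
  by rewrite ey exy subrr scale0r addr0.
have := @B_mono x (y ord0 j - x ord0 j); rewrite -ey subr_gt0 => /(_ xy Bx By).
by rewrite eg subrr mulr0 ltNge mulr_ge0 // subr_ge0 ltW.
Qed.

(** The intermediate value theorem in direction [j]. The control by [eta] yields local surjectivity
    here and the continuity of the inverse later. *)
Let phi_surj q (eta : R) : B q -> 0 < eta -> exists2 d : R, 0 < d &
  forall y, `|y - phi q| < d -> exists x, [/\ B x, `|x - q| <= eta & phi x = y].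
Proof.
wlog eta_le : eta / eta <= (r - `|q - p|) / 2.
  move=> H Bq eta0; have rq : 0 < (r - `|q - p|) / 2.
    by rewrite divr_gt0 // subr_gt0.
  have [||d d0 Hd] := H (Num.min eta ((r - `|q - p|) / 2)) _ Bq.
  - by rewrite ge_min lexx orbT.
  - by rewrite lt_min eta0.
  exists d => // y /Hd[x [h1 h2 h3]]; exists x; split => //.
  by apply: le_trans h2 _; rewrite ge_min lexx.
move=> Bq eta0.
have e_norm (t : R) : `|t *: (ee j)| = `|t|.
  exact: norm_scale_delta.
have inB x (t : R) : `|x - q| < (r - `|q - p|) / 2 -> `|t| <= eta -> B (x + t *: (ee j)).
  move=> xq te; rewrite /B /=.
  have -> : x + t *: (ee j) - p = (x - q) + t *: (ee j) + (q - p).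
    by apply/rowP => i; rewrite !mxE; ring.
  apply: le_lt_trans (ler_normD _ _) _; rewrite -ltrBrDr.
  apply: le_lt_trans (ler_normD _ _) _; rewrite e_norm.
  by apply: lt_le_trans (ltr_leD xq (le_trans te eta_le)) _; lra.
have q0 : `|q - q| < (r - `|q - p|) / 2 by rewrite subrr normr0 divr_gt0 // subr_gt0.
(* By [B_mono], [g] changes by more than [m] between [q] and either end of the segment of
   half-length [eta]. If the end values and the target value each move by less than [m / 2], the
   target remains between the end values. *)
pose m := eta * (`|c| / 2).
have m0 : 0 < m by rewrite mulr_gt0 // divr_gt0 // normr_gt0.
have Bqp : B (q + eta *: (ee j)) by apply: inB => //; rewrite gtr0_norm.
have Bqm : B (q + (- eta) *: (ee j)) by apply: inB => //; rewrite normrN gtr0_norm.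
have mp : m < sg * (g (q + eta *: (ee j)) - g q) by exact: B_mono.
have mm : m < sg * (g q - g (q + (- eta) *: (ee j))).
  have := @B_mono (q + (- eta) *: (ee j)) eta eta0 Bqm.
  by rewrite -addrA -scalerDl addNr scale0r addr0; apply.
have cont z : B z -> exists2 d : R, 0 < d & forall w, `|w - z| < d -> `|g w - g z| < m / 2.
  move=> Bz; have /cvgrPdist_lt h := class_C_continuous Cg (BU Bz).
  have m2 : 0 < m / 2 by rewrite divr_gt0.
  have /nbhs_ballP[d /= d0 Hd] := h _ m2; exists d => // w wz.
  by rewrite distrC; apply: Hd; rewrite -ball_normE /= distrC.
have [d1 d10 Hd1] := cont _ Bqp; have [d2 d20 Hd2] := cont _ Bqm.
exists (Num.min (Num.min d1 d2) (Num.min (m / 2) (Num.min eta ((r - `|q - p|) / 2)))).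
  by rewrite !lt_min d10 d20 eta0 divr_gt0 // divr_gt0 // subr_gt0.
move=> y; rewrite !lt_min => /and3P[/andP[y1 y2] y3 /andP[y4 y5]].
pose x' := row_upd y j (q ord0 j).
have x'q : `|x' - q| <= `|y - phi q|.
  apply: norm_le_coord => // i; rewrite !mxE; case: eqP => [->|/eqP ij].
    by rewrite subrr normr0.
  by have := coord_le_norm (y - phi q) i; rewrite !mxE (negPf ij).
have yj : `|y ord0 j - g q| < m / 2.
  by apply: le_lt_trans y3; have := coord_le_norm (y - phi q) j; rewrite !mxE eqxx.
have dK (a b e : 'rV[R]_n) : a + e - (b + e) = a - b by rewrite opprD addrACA subrr addr0.
have gp : `|g (x' + eta *: (ee j)) - g (q + eta *: (ee j))| < m / 2.
  by apply: Hd1; rewrite dK; exact: le_lt_trans y1.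
have gm : `|g (x' + (- eta) *: (ee j)) - g (q + (- eta) *: (ee j))| < m / 2.
  by apply: Hd2; rewrite dK; exact: le_lt_trans y2.
have x'r : `|x' - q| < (r - `|q - p|) / 2 by exact: le_lt_trans y5.
pose G (t : R) := g (x' + t *: (ee j)).
have [|||t] := @IVT R G (- eta) eta (y ord0 j).
- by rewrite ge0_cp // ltW.
- apply: continuous_in_subspaceT => t; rewrite inE /= in_itv /= => ht.
  have Bt : B (x' + t *: (ee j)) by apply: inB => //; rewrite ler_norml.
  have [d _] := @is_derive_line R n R g x' (ee j) t ((Cg.2 j).1 _ (BU Bt)).
  by apply: differentiable_continuous; exact/derivable1_diffP.
- move: mp mm yj gp gm; rewrite /sg !ltr_norml /G.
  set g1 := g (x' + eta *: _); set g2 := g (x' + (- eta) *: _).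
  case: ifP => _ mp mm /andP[yj1 yj2] /andP[gp1 gp2] /andP[gm1 gm2];
  rewrite ge_min le_max; apply/andP; split; apply/orP; lra.
rewrite in_itv /= => ht e; exists (x' + t *: (ee j)).
have te : `|t| <= eta by rewrite ler_norml.
split; first exact: inB.
  apply: norm_le_coord; first exact: ltW.
  move=> i; rewrite !mxE /=; case: eqP => [->|/eqP ij].
    by rewrite mulr1 addrAC subrr add0r.
  rewrite mulr0 addr0; have := coord_le_norm (y - phi q) i; rewrite !mxE (negPf ij) => h.
  exact: le_trans h (ltW y4).
apply/rowP => i; rewrite !mxE /=; case: eqP => [->|/eqP ij]; first exact: e.
by rewrite mulr0 addr0.
Qed.

(** Once [psi] is known to be continuous, its smoothness is bootstrapped from an explicit formula
    for its partial derivatives. *)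
Lemma straightening : exists (W : set 'rV[R]_n) (psi : 'rV[R]_n -> 'rV[R]_n) (s : R),
  let V := [set y | `|y - phi p| < s] in
  [/\ 0 < s, [/\ open W, W p & W `<=` U], class_C_map k.+1 V psi,
      forall x, W x -> V (phi x) /\ psi (phi x) = x &
      forall y, V y -> W (psi y) /\ phi (psi y) = y].
Proof.
have Bp : B p by rewrite /B /= subrr normr0 r_gt0.
have [s s0 Hs] := phi_surj Bp ltr01.
pose V := [set y | `|y - phi p| < s].
have /choice[psi Hpsi] : forall y, exists x, V y -> B x /\ phi x = y.
  move=> y; have [/Hs[x [h1 _ h2]]|] := pselect (V y); first by exists x.
  by exists p.
have oV : open V.
  apply/open_normP => x Bx; exists (s - `|x - phi p|); first by rewrite subr_gt0.
  move=> y yx; rewrite /V /= -(subrKA x); apply: le_lt_trans (ler_normD _ _) _.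
  by rewrite -ltrBrDr.
have cphi x : B x -> {for x, continuous phi}.
  move=> Bx; apply: rV_continuous => i; have [->|ij] := eqVneq i j.
    rewrite (_ : (fun y => _) = g); first exact: class_C_continuous Cg (BU Bx).
    by apply/funext => y; rewrite mxE eqxx.
  rewrite (_ : (fun y => _) = fun y => y ord0 i); first exact: coord_continuous.
  by apply/funext => y; rewrite mxE (negPf ij).
have psiE x : B x -> V (phi x) -> psi (phi x) = x.
  by move=> Bx Vx; have [h1 h2] := Hpsi _ Vx; exact: phi_inj.
have cpsi y : V y -> {for y, continuous psi}.
  move=> Vy; have [Bq eq_] := Hpsi y Vy.
  apply/continuous_normP => e e0; have e2 : 0 < e / 2 by rewrite divr_gt0.
  have [d d0 Hd] := phi_surj Bq e2; have [d' d'0 Hd'] := (open_normP V).1 oV y Vy.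
  exists (Num.min d d'); first by rewrite lt_min d0.
  move=> z; rewrite lt_min => /andP[zy /Hd' Vz].
  move: zy; rewrite -{1}eq_ => /Hd[x [Bx xq ex]].
  rewrite -{1}ex psiE ?ex //; apply: le_lt_trans xq _; lra.
pose W := B `&` phi @^-1` V.
exists W, psi, s; split => //.
- split; [|by split => //; rewrite /V /= subrr normr0|by move=> x [/BU]].
  rewrite openE => x [Bx Vx]; apply: filterI; first exact: open_nbhs_nbhs.
  by apply: (cphi x Bx); exact: open_nbhs_nbhs.
(* Implicit differentiation of [g (psi y) = y ord0 j] gives [Q i (psi y)] as the partial derivative
   of coordinate [j] of [psi]; its other coordinates are those of [y]. *)
- pose Q i x := (if i == j then 1 else - 'D_(ee i) g x) / 'D_(ee j) g x.
  have D0 x : B x -> 'D_(ee j) g x != 0.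
    move=> /B_deriv; apply: contraTneq => ->; rewrite mulr0 -leNgt.
    by rewrite divr_ge0.
  have CQ i : class_C k B (Q i).
    have Cd l : class_C k B ('D_(ee l) g) by apply: class_C_sub BU _; exact: (Cg.2 l).2.
    apply: (class_CM B_open _ (class_CV B_open D0 (Cd j))).
    case: (i == j); first exact: class_C_cst.
    exact: class_CN.
  have psi_i y i : V y -> i != j -> psi y ord0 i = y ord0 i.
    move=> Vy ij; have [_ h] := Hpsi y Vy.
    by move/rowP/(_ i): h; rewrite mxE (negPf ij).
  have g_psi y : V y -> g (psi y) = y ord0 j.
    by move=> Vy; have [_ h] := Hpsi y Vy; move/rowP/(_ j): h; rewrite mxE eqxx.
  have dpsi y i : V y -> is_derive y (ee i) (fun z => psi z ord0 j) (Q i (psi y)).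
    move=> Vy; have [Bq _] := Hpsi y Vy; set q := psi y in Bq *.
    (* By the mean value theorem for [g] between [q] and the displaced value of [psi], the
       difference quotient equals [Q i] at an intermediate point [xi t], which tends to [q] by
       continuity of [psi]. *)
    have /choice[xi Hxi] : forall t : R, exists x, `|x - q| <= `|psi (t *: (ee i) + y) - q| /\
        (V (t *: (ee i) + y) -> t != 0 ->
          t^-1 *: (psi (t *: (ee i) + y) ord0 j - psi y ord0 j) = Q i x).
      move=> t; have [[Vt t0]|nVt] := pselect (V (t *: (ee i) + y) /\ t != 0); last first.
        by exists q; rewrite subrr normr0; split => // h1 h2; case: nVt.
      have [Bt _] := Hpsi _ Vt; set x := psi (t *: (ee i) + y) in Bt *.
      have Bs (u : R) : 0 <= u <= 1 -> B (q + u *: (x - q)) by exact: ball_convex.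
      have [u u01] := class_C_mvt B_open (class_C_sub BU Cg) Bs.
      set z := q + u *: (x - q) => e.
      exists z; split.
        rewrite /z addrAC subrr add0r normrZ; case/andP: u01 => u0 u1.
        by rewrite ger0_norm // ler_piMl.
      move=> _ _; have Dz := D0 _ (Bs u u01); rewrite -/z in Dz.
      have xl l : l != j -> (x - q) ord0 l = t * (l == i)%:R.
        by move=> lj; rewrite !mxE (psi_i _ _ Vt lj) (psi_i _ _ Vy lj) !mxE eqxx addrK.
      move: e; rewrite /x /q (g_psi _ Vt) (g_psi _ Vy) -/x -/q !mxE eqxx addrK /= (bigD1 j) //=.
      rewrite (eq_bigr (fun l => t * (l == i)%:R * 'D_(ee l) g z)) => [|l lj]; last first.
        by rewrite xl.
      rewrite !mxE -[_^-1 *: _]/(t^-1 * (x ord0 j - q ord0 j)).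
      set w := x ord0 j - q ord0 j => e; apply: (mulfI t0); apply: (mulIf Dz).
      rewrite mulrA divff // mul1r /Q mulrA -mulrA mulVf // mulr1; move: e.
      have [->|ij] := eqVneq i j.
        rewrite !mulr1 big1 => [|l /negPf->]; last by rewrite mulr0 mul0r.
        by rewrite addr0.
      rewrite mulr0 (bigD1 i) //= big1 => [|l /andP[_ /negPf->]]; last first.
        by rewrite mulr0 mul0r.
      by rewrite eqxx mulr1 addr0 => /esym/eqP; rewrite addr_eq0 mulrN => /eqP.
    have cline : {for (0 : R), continuous (fun t : R => t *: (ee i) + y)}.
      by move=> t; apply: cvgD; [apply: cvgZr_tmp; exact: cvg_id|exact: cvg_cst].
    have cpl : (psi (t *: (ee i) + y)) @[t --> (0 : R)] --> q.
      have -> : q = psi ((0 : R) *: (ee i) + y) by rewrite scale0r add0r.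
      apply: (@continuous_comp _ _ _ (fun t : R => t *: (ee i) + y) psi) => //.
      by rewrite /= scale0r add0r; exact: cpsi.
    have cxi : xi t @[t --> (0 : R)] --> q.
      apply/cvgrPdist_lt => e e0; move/cvgrPdist_lt: cpl => /(_ e e0).
      apply: filterS => t h; rewrite distrC; apply: le_lt_trans (Hxi t).1 _.
      by rewrite distrC.
    have cQ : Q i (xi t) @[t --> (0 : R)] --> Q i q.
      exact: (cvg_comp _ _ cxi (class_C_continuous (CQ i) Bq)).
    have lim : t^-1 *: (psi (t *: (ee i) + y) ord0 j - psi y ord0 j) @[t --> (0 : R)^'] --> Q i q.
      have cQ' : Q i (xi t) @[t --> (0 : R)^'] --> Q i q.
        by apply: cvg_trans cQ; apply: cvg_app; exact: cvg_within.
      apply: cvg_trans cQ'; apply: near_eq_cvg.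
      near=> t.
      apply/esym/(Hxi t).2; last by near: t; exact: nbhs_dnbhs_neq.
      near: t; apply: nbhs_dnbhs.
      by apply: (cline); rewrite scale0r add0r; exact: open_nbhs_nbhs.
    apply: DeriveDef; first by apply/cvg_ex; exists (Q i q).
    exact: cvg_lim lim.
  (* If [psi] is of class C^m with m at most k, so are its partial derivatives [Q i \o psi], and
     [psi] is of class C^(m+1). *)
  have Cpsi m : (m <= k.+1)%N -> class_C_map m V psi.
    elim: m => [_|m IH mk] l.
      split => // y Vy; apply: (@continuous_comp _ _ _ psi (fun z => z ord0 l)).
        exact: cpsi.
      exact: coord_continuous.
    have [->|lj] := eqVneq l j; last first.
      apply: class_C_eq (class_C_coord m.+1 V l) => // y Vy; by rewrite psi_i.
    split.
      move=> y Vy; apply: (@continuous_comp _ _ _ psi (fun z => z ord0 j)).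
        exact: cpsi.
      exact: coord_continuous.
    move=> i; split; first by move=> y Vy; have [] := dpsi y i Vy.
    have C : class_C m V (Q i \o psi).
      have Bpsi z : V z -> B (psi z) by move=> /Hpsi[].
      have mk' : (m <= k)%N by [].
      exact: (class_C_comp B_open oV Bpsi (class_C_le mk' (CQ i)) (IH (ltnW mk))).
    by apply: class_C_eq C => // y Vy; have [_ ->] := dpsi y i Vy.
  exact: Cpsi.
- move=> x [Bx Vx]; split => //; exact: psiE.
- move=> y Vy; have [h1 h2] := Hpsi y Vy; split => //; split => //.
  by rewrite /= h2.
Unshelve. all: by end_near. Qed.

End Straightening.

End Chart.

(** * Null sets *)

Section NullSets.
Context {R : realType} {n : nat}.
Implicit Types (f : 'rV[R]_n -> R) (A : set 'rV[R]_n).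

Local Notation null X := (lebesgue_measure.-negligible (X : set R)).

Lemma negligible_small_cover (X : set R) :
  (forall e : R, 0 < e -> exists Y : set R,
    [/\ measurable Y, X `<=` Y & (lebesgue_measure Y <= e%:E)%E]) -> null X.
Proof.
move=> H; have /choice[Y HY] : forall k : nat, exists Y : set R,
    [/\ measurable Y, X `<=` Y & (lebesgue_measure Y <= (k.+1%:R^-1 : R)%:E)%E].
  by move=> k; apply: H; rewrite invr_gt0.
have mY : measurable (\bigcap_k Y k).
  by apply: bigcapT_measurable => k; have [] := HY k.
exists (\bigcap_k Y k); split => //; last first.
  by move=> x Xx k _; have [_ h _] := HY k; exact: h.
apply/eqP; rewrite eq_le measure_ge0 andbT; apply/lee_addgt0Pr => e e0.
rewrite add0e.
have [k ke] : exists k : nat, k.+1%:R^-1 < e.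
  exists (Num.bound e^-1); rewrite invf_plt ?posrE //.
  apply: (@lt_trans _ _ (Num.bound e^-1)%:R); last by rewrite ltr_nat.
  by apply: archi_boundP; rewrite invr_ge0 ltW.
have [mk _ hk] := HY k.
apply: (@le_trans _ _ (k.+1%:R^-1 : R)%:E); last by rewrite lee_fin ltW.
apply: le_trans hk; apply: le_measure; rewrite ?inE //.
by move=> x; apply.
Qed.

(** Bisection is applied to covers of measure at most [e'] times the volume of the box. Such bounds
    add up over two halves, and on a small cube of side t the image lies in an interval of length
    [e'] t^n. The estimate is asked at every point of the cube because the nested cubes may shrink
    to a point outside [A]. *)
Lemma negligible_flat_image (a : 'rV[R]_n) (s : R) A f : 0 < s ->
  (forall p, box a (a + const_mx s) p -> forall e : R, 0 < e ->
    exists2 d : R, 0 < d & forall x y, A x -> A y -> `|x - p| < d -> `|y - p| < d ->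
      `|f x - f y| <= e * `|x - y| ^+ n) ->
  null (f @` (A `&` box a (a + const_mx s))).
Proof.
move=> s0 flat; apply: negligible_small_cover => e e0.
pose vol (a b : 'rV[R]_n) : R := \prod_(i < n) (b ord0 i - a ord0 i).
have vol_cube (x : 'rV[R]_n) (t : R) : vol x (x + const_mx t) = t ^+ n.
  rewrite /vol (eq_bigr (fun=> t)) ?prodr_const ?card_ord // => i _.
  by rewrite !mxE addrAC subrr add0r.
pose e' := e / s ^+ n.
have e'0 : 0 < e' by rewrite divr_gt0 // exprn_gt0.
pose P (a b : 'rV[R]_n) := exists Y : set R,
  [/\ measurable Y, f @` (A `&` box a b) `<=` Y &
   (lebesgue_measure Y <= (e' * vol a b)%:E)%E].
suff [Y [mY XY hY]] : P a (a + const_mx s).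
  by exists Y; split => //; move: hY; rewrite vol_cube divfK // gt_eqF // exprn_gt0.
apply: (cube_bisection (P := P)) => //.
  move=> u v j uv; set m := (_ + _) / 2 => -[Y1 [mY1 h1 l1]] [Y2 [mY2 h2 l2]].
  exists (Y1 `|` Y2); split; first exact: measurableU.
    move=> _ [x [Ax bx] <-]; have [xm|xm] := leP (x ord0 j) m; [left; apply: h1|right; apply: h2];
      exists x => //; split => // i; rewrite mxE; have := bx i; case: eqP => [->|_] // /andP[? ?];
      by apply/andP; split => //; exact: ltW.
  apply: (le_trans (@measureU2 _ _ _ lebesgue_measure _ _ mY1 mY2)).
  apply: le_trans (leeD l1 l2) _; rewrite -EFinD lee_fin -mulrDr.
  rewrite le_eqVlt; apply/orP; left; apply/eqP; congr (_ * _).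
  rewrite /vol (bigD1 j) //= [X in _ + X](bigD1 j) //= [RHS](bigD1 j) //= !mxE eqxx.
  rewrite (eq_bigr (fun i => v ord0 i - u ord0 i)) => [|i /negPf ij]; last by rewrite mxE ij.
  rewrite [X in _ + _ * X](eq_bigr (fun i => v ord0 i - u ord0 i)) => [|i /negPf ij]; last by rewrite mxE ij.
  by rewrite -mulrDl; congr (_ * _); ring.
(* Half of [e'], because the interval is centred at the value of one point and its length is twice
   its radius. *)
move=> p bp; have e2 : 0 < e' / 2 by rewrite divr_gt0.
have [d d0 Hd] := flat p bp _ e2; exists d => // a' t /andP[t0 td] ap _.
rewrite /P vol_cube.
have near x : box a' (a' + const_mx t) x -> forall y, box a' (a' + const_mx t) y -> `|x - y| <= t.
  move=> bx y by_; apply: norm_le_coord; first exact: ltW.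
  move=> i; have := bx i; have := by_ i; rewrite !mxE => /andP[? ?] /andP[? ?].
  by rewrite ler_norml; apply/andP; split; lra.
have [[x0 [Ax0 bx0]]|no] := pselect (exists x, (A `&` box a' (a' + const_mx t)) x); last first.
  exists set0; split => //.
    by move=> y [x hx _]; case: no; exists x.
  by rewrite measure0 lee_fin mulr_ge0 ?exprn_ge0 // ltW.
pose D := e' / 2 * t ^+ n.
have D0 : 0 <= D by rewrite /D mulr_ge0 ?exprn_ge0 // ltW.
exists `[f x0 - D, f x0 + D]%classic; split => //.
  move=> _ [x [Ax bx] <-]; rewrite /= in_itv /= -ler_distl.
  have lt y : box a' (a' + const_mx t) y -> `|y - p| < d.
    by move=> by_; exact: le_lt_trans (near _ by_ _ ap) td.
  apply: le_trans (Hd x x0 Ax Ax0 (lt _ bx) (lt _ bx0)) _.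
  rewrite /D ler_wpM2l ?(ltW e2) //.
  by rewrite lerXn2r ?nnegrE ?(ltW t0) //; exact: near.
rewrite lebesgue_measure_itv /= lte_fin; case: ifP => _; last first.
  by rewrite lee_fin mulr_ge0 ?exprn_ge0 // ltW.
by rewrite -EFinB lee_fin /D; lra.
Qed.

Lemma negligible_bigcup_countable (I : countType) (F : I -> set R) :
  (forall i, null (F i)) -> null (\bigcup_i F i).
Proof.
move=> H; pose E k := if @pickle_inv I k is Some i then F i else set0.
apply: (@negligibleS _ _ _ lebesgue_measure (\bigcup_k E k)).
  move=> x [i _ Fx]; exists (pickle i) => //.
  by rewrite /E pickleK_inv.
apply: negligible_bigcup => k; rewrite /E; case: pickle_inv => [i|]; first exact: H.
exact: negligible_set0.
Qed.

(** Lindelof's argument with the countably many balls of rational centre and radius 1/(k+1). *)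
Lemma negligible_local A f :
  (forall p, A p -> exists2 d : R, 0 < d & null (f @` (A `&` [set x | `|x - p| < d]))) ->
  null (f @` A).
Proof.
move=> H.
pose rb (c : 'rV[rat]_n * nat) : set 'rV[R]_n :=
  [set x | `|x - map_mx ratr c.1| < c.2.+1%:R^-1].
(* Balls whose image is not negligible are replaced by the empty set, so that the countable union is
   negligible as a whole. *)
pose F (c : 'rV[rat]_n * nat) : set R :=
  if `[< null (f @` (A `&` rb c)) >] then f @` (A `&` rb c) else set0.
apply: (@negligibleS _ _ _ lebesgue_measure (\bigcup_c F c)); last first.
  apply: negligible_bigcup_countable => c; rewrite /F; case: asboolP => // _.
  exact: negligible_set0.
move=> _ [p Ap <-]; have [d d0 Hd] := H p Ap.
have [k ke] : exists k : nat, k.+1%:R^-1 < d / 2.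
  have d2 : 0 < d / 2 by rewrite divr_gt0.
  exists (Num.bound (d / 2)^-1); rewrite invf_plt ?posrE //.
  apply: (@lt_trans _ _ (Num.bound (d / 2)^-1)%:R); last by rewrite ltr_nat.
  by apply: archi_boundP; rewrite invr_ge0 ltW.
have k0 : 0 < k.+1%:R^-1 :> R by rewrite invr_gt0.
have /choice[q Hq] : forall i : 'I_n, exists q : rat, `|p ord0 i - ratr q| < k.+1%:R^-1.
  move=> i; have [|q] := @rat_in_itvoo R (p ord0 i - k.+1%:R^-1) (p ord0 i + k.+1%:R^-1).
    by rewrite ltrD2l gtrN.
  by rewrite in_itv /= => /andP[h1 h2]; exists q; rewrite ltr_distlC h1.
exists (\row_i q i, k) => //.
have pq : `|p - map_mx ratr (\row_i q i)| < k.+1%:R^-1.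
  by apply: norm_lt_coord => // i; rewrite !mxE.
have E : null (f @` (A `&` rb (\row_i q i, k))).
  apply: negligibleS Hd => _ [x [Ax hx] <-]; exists x => //; split => //=.
  rewrite -(subrKA (map_mx ratr (\row_i q i))); apply: le_lt_trans (ler_normD _ _) _.
  have hx' : `|x - map_mx ratr (\row_i q i)| < k.+1%:R^-1 := hx.
  rewrite [X in _ + X]distrC; apply: lt_trans (ltrD hx' pq) _.
  by rewrite [ltRHS](splitr d); exact: ltrD.
rewrite /F; case: asboolP => // _; exists p => //; split => //.
Qed.

End NullSets.

(** * Sard's theorem *)

Section Sard.
Context {R : realType} {n : nat}.
Implicit Types (f g : 'rV[R]_n -> R) (A S U V : set 'rV[R]_n) (I : {set 'I_n}).

Local Notation ee i := (@delta_mx R 1 n ord0 i).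
Local Notation null X := (lebesgue_measure.-negligible (X : set R)).

Definition coord_plane I : set 'rV[R]_n := [set x | forall i, i \notin I -> x ord0 i = 0].

Definition curve_in S (L : R) (gam : R -> 'rV[R]_n) :=
  forall t : R, 0 <= t <= 1 -> [/\ S (gam t), derivable gam t 1 &
    forall i, `|('D_1 gam t) ord0 i| <= L].

(** A curve in [coord_plane I] has no velocity in the directions outside [I], so only derivatives
    along [I] count; each of the [n] terms of the chain rule is at most [e * L]. *)
Lemma curve_mvt k U I g L e gam : open U -> class_C k.+1 U g -> 0 <= L -> 0 <= e ->
  curve_in (U `&` coord_plane I) L gam ->
  (forall t : R, 0 <= t <= 1 -> forall i, i \in I -> `|'D_(ee i) g (gam t)| <= e) ->
  forall t : R, 0 <= t <= 1 -> `|g (gam t) - g (gam 0)| <= n%:R * e * L.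
Proof.
move=> oU Cg L0 e0 cg ge t /andP[t0 t1].
have C0 : 0 <= n%:R * e * L by rewrite !mulr_ge0.
move: t0; rewrite le_eqVlt => /orP[/eqP<-|t0]; first by rewrite subrr normr0.
pose dphi (s : R) := \sum_(i < n) ('D_1 gam s) ord0 i * 'D_(ee i) g (gam s).
have d (s : R) : 0 <= s <= 1 -> is_derive s 1 (g \o gam) (dphi s).
  move=> /cg[[Us _] ds _]; apply: deriv_curve; first exact: class_C_differentiable Cg Us.
  exact: derivableP.
have [||s s01 e1] := @MVT R (g \o gam) dphi 0 t t0.
- by move=> s; rewrite in_itv /= => /andP[s0 s1]; apply: d; rewrite !ltW //; exact: lt_le_trans t1.
- apply: continuous_in_subspaceT => s; rewrite inE /= in_itv /= => /andP[s0 s1].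
  have [|h _] := d s; first by rewrite s0 (le_trans s1).
  by apply: differentiable_continuous; exact/derivable1_diffP.
move: e1; rewrite /= subr0 => ->; move: s01; rewrite in_itv /= => /andP[s0 s1].
have s01 : 0 <= s <= 1 by rewrite !ltW //; exact: lt_le_trans t1.
rewrite normrM (gtr0_norm t0); apply: le_trans (_ : n%:R * e * L * 1 <= _); last by rewrite mulr1.
apply: ler_pM => //; first exact: ltW.
rewrite /dphi; apply: le_trans (ler_norm_sum _ _ _) _.
apply: le_trans (ler_sum _ (fun i _ => _ : _ <= e * L)) _; last first.
  by rewrite sumr_const card_ord -[leLHS]mulr_natl mulrA.
have [_ ds dL] := cg s s01.
move=> i _; rewrite normrM mulrC; have [iI|iI] := boolP (i \in I).
  by apply: ler_pM => //; exact: ge.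
rewrite (_ : 'D_1 gam s ord0 i = 0) ?normr0 ?mulr0 ?mulr_ge0 //.
rewrite derive_mx // mxE.
rewrite (@near_eq_derive _ _ _ _ (cst 0 : R -> R)) ?derive_cst //.
have : \forall u \near s, 0 < u < 1.
  by apply: near_in_itvoo; rewrite in_itv /= s0 (lt_le_trans s1).
apply: filterS => u /andP[u0 u1]; have [|[_ h] _ _] := cg u; first by rewrite !ltW.
exact: h.
Qed.

(* [flat A G s C f]: along a curve of speed at most L issued from A on which the
   functions G are bounded by e, the variation of f is at most C e L^s.  This
   is stable under composition with Lipschitz maps. *)
Definition flat S A (T : finType) (G : T -> 'rV[R]_n -> R) (s : nat) (C : R) f :=
  forall gam L e, 0 <= L -> 0 <= e -> curve_in S L gam -> A (gam 0) ->
    (forall t : R, 0 <= t <= 1 -> forall i, `|G i (gam t)| <= e) ->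
    `|f (gam 1) - f (gam 0)| <= C * e * L ^+ s.

Lemma curve_in_segment S x y : is_convex S -> S x -> S y ->
  curve_in S `|y - x| (fun t : R => x + t *: (y - x)).
Proof.
move=> cS Sx Sy t t01; have dI : derivable (@id 'rV[R]_n) (x + t *: (y - x)) (y - x).
  exact: derivable_id.
have [d1 d2] := is_derive_line dI; split => //; first exact: cS.
by move=> i; rewrite d2 derive_id; exact: coord_le_norm.
Qed.

Lemma coord_plane_convex I : is_convex (coord_plane I).
Proof. by move=> x y t hx hy _ i iI; rewrite !mxE hx // hy // subrr mulr0 addr0. Qed.

(** Near a common zero the continuous functions [G i] are small along the segments joining points of
    [A], so flatness of order s >= n is the estimate asked by [negligible_flat_image]. *)
Lemma flat_negligible U I A (T : finType) (G : T -> 'rV[R]_n -> R) s C f : open U ->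
  A `<=` U `&` coord_plane I -> (forall i, class_C 0 U (G i)) ->
  (forall i x, A x -> G i x = 0) -> 0 <= C ->
  flat (U `&` coord_plane I) A G s C f -> (n <= s)%N -> null (f @` A).
Proof.
move=> oU AU CG GA C0 Ff ns; apply: negligible_local => p Ap.
have [d d0 Hd] := (open_normP U).1 oU p (AU p Ap).1.
pose a : 'rV[R]_n := p - const_mx (d / 2).
exists (d / 2); first by rewrite divr_gt0.
have sub : A `&` [set x | `|x - p| < d / 2] `<=` A `&` box a (a + const_mx d).
  move=> x [Ax xp]; split => // i; have := le_lt_trans (coord_le_norm (x - p) i) xp.
  by rewrite /a !mxE ltr_norml => /andP[? ?]; apply/andP; split; lra.
suff : null (f @` (A `&` box a (a + const_mx d))).
  by apply: negligibleS; exact: image_subset sub.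
apply: negligible_flat_image => // q bq e e0.
have Uq : U q.
  apply: Hd; apply: le_lt_trans (_ : d / 2 < d); last lra.
  apply: norm_le_coord; first by rewrite divr_ge0 // ltW.
  move=> i; have := bq i; rewrite /a !mxE => /andP[? ?].
  by rewrite ler_norml; apply/andP; split; lra.
(* Where some [G i] does not vanish there are no points of [A] nearby and the estimate is
   vacuous. *)
have [q0|] := pselect (forall i, G i q = 0); last first.
  move=> /existsNP[i /eqP Gq]; have Gq0 : 0 < `|G i q| by rewrite normr_gt0.
  have [r r0 Hr] := (continuous_normP _ _).1 (class_C_continuous (CG i) Uq) _ Gq0.
  exists r => // x y Ax _ xq _; have := Hr x xq.
  by rewrite GA // sub0r normrN ltxx.
pose e' := e / (C + 1).
have e'0 : 0 < e' by rewrite divr_gt0 // ltr_wpDl.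
have : nbhs q (U `&` [set x | forall i, `|G i x| <= e']).
  apply: filterI; first exact: open_nbhs_nbhs.
  have near_i i : \forall x \near q, `|G i x| <= e'.
    have [r r0 Hr] := (continuous_normP _ _).1 (class_C_continuous (CG i) Uq) _ e'0.
    apply/nbhs_ballP; exists r => // x; rewrite -ball_normE /= distrC => /Hr.
    by rewrite q0 subr0 => /ltW.
  exact: (@filter_forall _ T (fun i => [set x | `|G i x| <= e']) (nbhs q) _ near_i).
move=> /nbhs_ballP[r /= r0 Hr].
(* Two points within 1/2 of [q] are at distance at most 1, so that the power [s] is dominated by the
   power [n]. *)
exists (Num.min r (1 / 2)); first by rewrite lt_min r0 divr_gt0.
move=> y x Ay Ax; rewrite !lt_min => /andP[yr y1] /andP[xr x1].
have xy t : 0 <= t <= 1 -> `|x + t *: (y - x) - q| < r by move=> ?; exact: ball_convex.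
have Gxy t : 0 <= t <= 1 -> (U `&` [set x | forall i, `|G i x| <= e']) (x + t *: (y - x)).
  by move=> t01; apply: Hr; rewrite -ball_normE /= distrC; exact: xy.
have cxy : curve_in (U `&` coord_plane I) `|y - x| (fun t : R => x + t *: (y - x)).
  move=> t t01; have [_ d1 d2] := curve_in_segment (@coord_plane_convex I) (AU x Ax).2 (AU y Ay).2 t01.
  split => //; split; first exact: (Gxy t t01).1.
  exact: coord_plane_convex (AU x Ax).2 (AU y Ay).2 t01.
have := Ff _ _ e' (normr_ge0 _) (ltW e'0) cxy; rewrite scale0r addr0 scale1r addrCA subrr addr0.
move=> /(_ Ax (fun t t01 => (Gxy t t01).2)) h; apply: le_trans h _.
apply: ler_pM.
- by rewrite mulr_ge0 // ltW.
- by rewrite exprn_ge0.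
- by rewrite /e' mulrA ler_pdivrMr ?ltr_wpDl // mulrC ler_wpM2l ?(ltW e0) // lerDl.
- have y_x : `|y - x| <= 1.
    rewrite -(subrKA q); apply: le_trans (ler_normD _ _) _.
    by rewrite (distrC q x); lra.
  by rewrite -(subnK ns) exprD ler_piMl ?exprn_ge0 // exprn_ile1.
Qed.

(** [psi] turns curves of speed [L] into curves of speed at most [n%:R * M * L], whence the factor
    in the constant. *)
Lemma flat_pullback k U V I J A (T : finType) (G : T -> 'rV[R]_n -> R) s C f
    (psi : 'rV[R]_n -> 'rV[R]_n) (M : R) : open V -> 0 <= C -> 0 <= M ->
  class_C_map k.+1 V psi ->
  (forall y, V y -> forall i l, `|'D_(ee i) (fun z => psi z ord0 l) y| <= M) ->
  (forall y, V y -> coord_plane J y -> (U `&` coord_plane I) (psi y)) ->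
  flat (U `&` coord_plane I) A G s C f ->
  flat (V `&` coord_plane J) (V `&` coord_plane J `&` psi @^-1` A)
    (fun i => G i \o psi) s (C * (n%:R * M) ^+ s) (f \o psi).
Proof.
move=> oV C0 M0 Cpsi HM HV Ff gam L e L0 e0 cg [_ A0] Ge.
have L'0 : 0 <= n%:R * M * L by rewrite !mulr_ge0.
have cg' : curve_in (U `&` coord_plane I) (n%:R * M * L) (psi \o gam).
  move=> t t01; have [[Vt Jt] dt Lt] := cg t t01.
  have dl l : is_derive t 1 (fun u => psi (gam u) ord0 l)
      (\sum_(i < n) ('D_1 gam t) ord0 i * 'D_(ee i) (fun z => psi z ord0 l) (gam t)).
    apply: (deriv_curve (f := fun z => psi z ord0 l)).
      exact: class_C_differentiable (Cpsi l) Vt.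
    exact: derivableP.
  have dp : derivable (psi \o gam) t 1.
    by apply/derivable_mxP => i l; rewrite ord1; have [] := dl l.
  split => //; first exact: HV.
  move=> l; rewrite derive_mx // mxE; have [_ ->] := dl l.
  apply: le_trans (ler_norm_sum _ _ _) _.
  apply: le_trans (ler_sum _ (fun i _ => _ : _ <= M * L)) _; last first.
    by rewrite sumr_const card_ord -[leLHS]mulr_natl mulrA.
  by move=> i _; rewrite normrM mulrC; apply: ler_pM => //; exact: HM.
have := Ff _ _ e L'0 e0 cg' A0 Ge; rewrite exprMn => h.
by apply: le_trans h _; rewrite /= le_eqVlt; apply/orP; left; apply/eqP; ring.
Qed.

(** The smoothness [k] of the functions vanishing on [A] and the flatness order [s] are traded one
    for one, which preserves [n <= k + s]; [d] counts the free coordinates. The index type [T]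
    varies because each trade multiplies the functions. *)
Definition flat_images_null (d k : nat) := forall I U A (T : finType)
  (G : T -> 'rV[R]_n -> R) s C f, #|I| = d -> open U ->
  A `<=` U `&` coord_plane I -> (forall i, class_C k U (G i)) ->
  (forall i x, A x -> G i x = 0) -> 0 <= C ->
  flat (U `&` coord_plane I) A G s C f -> (n <= k + s)%N -> null (f @` A).

(* Points of A where all the relevant partial derivatives of the G i vanish gain
   one order of flatness at the cost of one order of smoothness; near the other
   points A lies in a hypersurface, and straightening it removes a coordinate. *)
Lemma flat_images_null_step d k : flat_images_null d k ->
  (forall d', (d' < d)%N -> flat_images_null d' k.+1) -> flat_images_null d k.+1.
Proof.
move=> IHk IHd I U A T G s C f hI oU AU CG GA C0 Ff nks.
pose A' := A `&` [set x | forall t i, i \in I -> 'D_(ee i) (G t) x = 0].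
apply: (@negligibleS _ _ _ lebesgue_measure (f @` A' `|` f @` (A `\` A'))).
  move=> _ [x Ax <-]; have [A'x|nA'x] := pselect (A' x); [left|right]; by exists x.
apply: negligibleU.
  (* Directions outside [I] receive the zero function, so that the index type is a plain product. *)
  pose G' (ti : T * 'I_n) x := if ti.2 \in I then 'D_(ee ti.2) (G ti.1) x else 0.
  apply: (IHk I U A' (T * 'I_n)%type G' s.+1 (C * n%:R) f hI oU) => //.
  - by move=> x [/AU].
  - move=> [t i]; rewrite /G' /=; case: (i \in I); last exact: class_C_cst.
    by have [_ /(_ i)[_ h]] := CG t.
  - by move=> [t i] x [_ h]; rewrite /G' /=; case: ifP => // iI; exact: h.
  - by rewrite mulr_ge0.
  (* The [G i] vanish at the start of the curve, so the mean value theorem bounds them by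
     [n%:R * e * L]; this supplies the additional power of [L]. *)
  - move=> gam L e L0 e0 cg [A0 _] Ge.
    have GeL t : 0 <= t <= 1 -> forall i, `|G i (gam t)| <= n%:R * e * L.
      move=> t01 i; have := @curve_mvt k U I (G i) L e gam oU (CG i) L0 e0 cg.
      move=> /(_ _ t t01); rewrite (GA i _ A0) subr0; apply.
      by move=> u u01 l lI; have := Ge u u01 (i, l); rewrite /G' /= lI.
    have h0 : 0 <= n%:R * e * L by rewrite !mulr_ge0.
    apply: le_trans (Ff gam L _ L0 h0 cg A0 GeL) _.
    by rewrite exprS le_eqVlt; apply/orP; left; apply/eqP; ring.
  - by rewrite addnS -addSn.
apply: negligible_local => p [Ap nA'p].
have [t [i [iI dG]]] : exists t i, i \in I /\ 'D_(ee i) (G t) p != 0.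
  apply: contrapT => no; apply: nA'p; split => // t i iI; apply/eqP; apply: contrapT => /negP ne.
  by apply: no; exists t, i.
have [Up Ip] := AU p Ap.
(* After straightening, [A] lies near [p] in the hyperplane where coordinate [i] vanishes, as [G t]
   is 0 on [A]. One free coordinate is lost and the order [k.+1] is kept. *)
have [W [psi [r [r0 [oW Wp WU] Cpsi phiK psiK]]]] := straightening oU (CG t) Up dG.
set phi := fun x => row_upd x i (G t x) in phiK psiK.
rewrite -/(phi p) in Cpsi phiK psiK.
set V0 := [set y | `|y - phi p| < r] in Cpsi phiK psiK.
have V0p : V0 (phi p) by rewrite /V0 /= subrr normr0.
have ball_open (c : 'rV[R]_n) (u : R) : open [set y | `|y - c| < u].
  apply/open_normP => x xc; exists (u - `|x - c|); first by rewrite subr_gt0.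
  move=> y yx /=; rewrite -(subrKA x); apply: le_lt_trans (ler_normD _ _) _.
  by rewrite -ltrBrDr.
(* [flat_pullback] asks for bounded partial derivatives of [psi]; continuity provides them on a
   smaller ball, with 1 as the allowed increase. *)
have [M [M0 [s1 [s10 s1r HM]]]] : exists M, 0 <= M /\ exists s1, [/\ 0 < s1, s1 <= r &
    forall y, `|y - phi p| < s1 -> forall j l, `|'D_(ee j) (fun z => psi z ord0 l) y| <= M].
  pose D (jl : 'I_n * 'I_n) y := 'D_(ee jl.1) (fun z => psi z ord0 jl.2) y.
  pose M := \big[Num.max/0]_(jl : 'I_n * 'I_n) `|D jl (phi p)| + 1.
  exists M; split; first by rewrite addr_ge0 // bigmax_ge_id.
  have near_jl jl : \forall y \near phi p, `|D jl y| <= M.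
    have [_ /(_ jl.1)[_ h]] := Cpsi jl.2.
    have [e e0 He] := (continuous_normP _ _).1 (class_C_continuous h V0p) _ ltr01.
    apply/nbhs_ballP; exists e => // y; rewrite -ball_normE /= distrC => /He He'.
    have := le_bigmax 0 (fun jl => `|D jl (phi p)|) jl => h1.
    rewrite -[D jl y](subrK (D jl (phi p))); apply: le_trans (ler_normD _ _) _.
    by rewrite addrC lerD // ltW.
  have near_all : nbhs (phi p) [set y | forall jl, `|D jl y| <= M].
    exact: (@filter_forall _ _ (fun jl => [set y | `|D jl y| <= M]) (nbhs (phi p)) _ near_jl).
  move: near_all => /nbhs_ballP[e /= e0 He]; exists (Num.min e r); split.
  - by rewrite lt_min e0.
  - by rewrite ge_min lexx orbT.
  - move=> y; rewrite lt_min => /andP[ye _] j l.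
    by apply: (He y _ (j, l)); rewrite -ball_normE /= distrC.
pose V := [set y | `|y - phi p| < s1].
have VV0 : V `<=` V0 by move=> y h; exact: lt_le_trans h s1r.
have psi_l y l : V0 y -> l != i -> psi y ord0 l = y ord0 l.
  by move=> /psiK[_] /rowP/(_ l); rewrite mxE => + /negPf li; rewrite li.
have HVJ y : V y -> coord_plane (I :\ i) y -> (U `&` coord_plane I) (psi y).
  move=> Vy Jy; split; first by apply: WU; case: (psiK y (VV0 _ Vy)).
  move=> l lI; have li : l != i by apply: contraNneq lI => ->.
  by rewrite (psi_l _ _ (VV0 _ Vy) li); apply: Jy; rewrite !inE (negPf lI) andbF.
have nullV : null ((f \o psi) @` (V `&` coord_plane (I :\ i) `&` psi @^-1` A)).
  apply: (IHd #|I :\ i| _ (I :\ i) V _ T (fun l => G l \o psi) s (C * (n%:R * M) ^+ s)) => //.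
  - by rewrite -hI (cardsD1 i I) iI.
  - exact: ball_open.
  - move=> l; apply: (class_C_comp oU (ball_open _ _) _ (CG l)).
      by move=> y /VV0/psiK[/WU].
    by move=> j; apply: class_C_sub VV0 _; exact: Cpsi.
  - by move=> l y [_]; exact: GA.
  - by rewrite mulr_ge0 // exprn_ge0 // mulr_ge0.
  - apply: (@flat_pullback k U V I (I :\ i) A T G s C f psi M) => //; first exact: ball_open.
    by move=> j; apply: class_C_sub VV0 _; exact: Cpsi.
have cphi : {for p, continuous phi}.
  apply: rV_continuous => l; have [->|li] := eqVneq l i.
    rewrite (_ : (fun y => _) = G t); first exact: class_C_continuous (CG t) Up.
    by apply/funext => y; rewrite mxE eqxx.
  rewrite (_ : (fun y => _) = fun y : 'rV[R]_n => y ord0 l); first exact: coord_continuous.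
  by apply/funext => y; rewrite mxE (negPf li).
have [e1 e10 He1] := (continuous_normP _ _).1 cphi _ s10.
have [e2 e20 He2] := (open_normP W).1 oW p Wp.
exists (Num.min e1 e2); first by rewrite lt_min e10.
apply: negligibleS nullV => w [x [[Ax _] /=]]; rewrite lt_min => /andP[x1 x2] <-.
have Vx : V (phi x) by exact: He1.
have [_ psix] := phiK x (He2 x x2).
exists (phi x); last by rewrite /= psix.
split; last by rewrite /= psix.
split => // l; rewrite !inE negb_and negbK => /orP[/eqP->|lI].
  by rewrite mxE eqxx GA.
rewrite mxE; case: eqP => [_|_]; first exact: GA.
exact: (AU x Ax).2.
Qed.

(** Lexicographic induction: straightening lowers [d] at the same order, while a gain in flatness
    lowers [k] for the same [d]. *)
Lemma flat_image_negligible d k : flat_images_null d k.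
Proof.
elim/ltn_ind: d k => d IHd; elim=> [|k IHk].
  by move=> I U A T G s C f _ oU AU CG GA C0 Ff ns; exact: flat_negligible Ff ns.
by apply: flat_images_null_step => // d' /IHd.
Qed.

Definition critical_set U f : set 'rV[R]_n := U `&` [set x | forall i, 'D_(ee i) f x = 0].

(** The [G i] are the partial derivatives of [f], of class n - 1, and the mean value theorem is
    flatness of order 1: the two orders add up to exactly [n]. *)
Theorem sard U f : (0 < n)%N -> open U -> class_C n U f -> null (f @` critical_set U f).
Proof.
move=> n0 oU Cn; have Cf : class_C n.-1.+1 U f by apply: class_C_le Cn; rewrite prednK.
apply: (@flat_image_negligible _ n.-1 [set: 'I_n]%SET U
  (critical_set U f) 'I_n (fun i => 'D_(ee i) f) 1%N n%:R f) => //.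
- by move=> x [Ux _]; split => // i; rewrite inE.
- by move=> i; have [_ /(_ i)[_ h]] := Cf.
- by move=> i x [].
- move=> gam L e L0 e0 cg [U0 _] Ge; rewrite expr1.
  apply: (curve_mvt oU Cf L0 e0 cg); last by rewrite ler01 lexx.
  by move=> t t01 i _; exact: Ge.
- by rewrite addn1 prednK.
Qed.

End Sard.

(** * Separating sets *)

Section Nested.
Context {T : topologicalType}.
Variable K : nat -> set T.
Hypotheses (clK : forall k, closed (K k)) (cK : compact (K 0%N))
  (decK : forall k, K k.+1 `<=` K k).

Lemma nested_sub k m : (k <= m)%N -> K m `<=` K k.
Proof.
move=> /subnK <-; elim: (m - k)%N => [//|d IH]; rewrite addSn.
exact: subset_trans (@decK _) IH.
Qed.

Lemma nested_compact_nonempty : (forall k, K k !=set0) -> \bigcap_k K k !=set0.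
Proof.
move=> /choice[x Hx].
have [|p [_ clp]] := cK (F := x @ \oo).
  by exists 0%N => // k _; exact: nested_sub (leq0n k) _ (Hx k).
exists p => k _; apply: clK => B Bp.
have [|y [Ky By]] := clp (K k) B _ Bp; last by exists y.
by exists k => // m /= km; exact: nested_sub km _ (Hx m).
Qed.

End Nested.

Section Separation.
Context {R : realType} {n : nat}.
Implicit Types (K S : set 'rV[R]_n) (p z : 'rV[R]_n).

(** Disjoint open neighbourhoods of the two pieces of a disconnection would, by compactness, cover
    some [K k], which is connected and meets both. *)
Lemma nested_connected (K : nat -> set 'rV[R]_n) : (forall k, closed (K k)) ->
  compact (K 0%N) -> (forall k, K k.+1 `<=` K k) -> (forall k, connected (K k)) ->
  connected (\bigcap_k K k).
Proof.
move=> clK cK decK conK; set M := \bigcap_k K k.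
have clM : closed M by apply: closed_bigI => k _; exact: clK.
apply/connectedP => E [E0 ME [s1 s2]].
have clE b : closed (E b).
  move=> x clx; have : M x by apply: clM; apply: closureS clx; rewrite ME; case: b; [right|left].
  rewrite ME => -[] Ex; case: b clx => // clx.
    have : (E false `&` closure (E true)) x by []. by rewrite s2.
  have : (closure (E false) `&` E true) x by []. by rewrite s1.
have E12 : E false `&` E true = set0.
  by rewrite -subset0 => x [h1 h2]; rewrite -s1; split => //; exact: subset_closure.
have [U [V [oU oV EU EV UV]]] := (@normal_openP R 'rV[R]_n).1 pseudometric_normal
  _ _ (clE false) (clE true) E12.
have [x h] : \bigcap_k (K k `&` ~` (U `|` V)) !=set0.
  apply: nested_compact_nonempty.
  - by move=> k; apply: closedI => //; apply: open_closedC; exact: openU.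
  - by apply: compact_closedI => //; apply: open_closedC; exact: openU.
  - by move=> k x [h1 h2]; split => //; exact: decK.
  - move=> k; apply: contrapT => no.
    have KUV : K k `<=` U `|` V.
      by move=> x Kx; apply: contrapT => nx; apply: no; exists x.
    have [x Ex] := E0 false; have [y Ey] := E0 true.
    have KU : K k `<=` U.
      apply: connected_open_sub => //.
        move=> w [Kw clw]; have [//|Vw] := KUV w Kw.
        by have [w' [Uw' Vw']] := clw V (open_nbhs_nbhs (conj oV Vw));
          have : (U `&` V) w' by []; rewrite UV.
      exists x; split; last exact: EU.
      by have : M x by [rewrite ME; left]; apply.
    have : (U `&` V) y.
      split; last exact: EV.
      by apply: KU; have : M y by [rewrite ME; right]; apply.
    by rewrite UV.
have Mx' : M x by move=> k _; case: (h k I).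
have [_ nUV] := h 0%N I; apply: nUV.
by move: Mx'; rewrite ME => -[/EU|/EV]; [left|right].
Qed.

Definition separates K p z := ~ connected_component (~` K) p z.

Lemma path_image_bounded (gam : R -> 'rV[R]_n) : continuous gam ->
  [/\ connected (gam @` `[0, 1]), compact (gam @` `[0, 1]) & bounded_set (gam @` `[0, 1])].
Proof.
move=> cg; have cg' : {within `[0, 1], continuous gam} by exact: continuous_subspaceT.
have c : compact (gam @` `[0, 1]) by apply: continuous_compact => //; exact: segment_compact.
split => //; last exact: compact_bounded.
by apply: connected_continuous_connected => //; exact: segment_connected.
Qed.

Lemma not_separates_path K p z : closed K -> ~ separates K p z ->
  exists gam : R -> 'rV[R]_n, [/\ continuous gam, gam 0 = p, gam 1 = z &
    forall t, ~ K (gam t)].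
Proof.
move=> cK /contrapT[S [Sp SK cS] Sz]; apply: (connected_path cK cS) => //.
by rewrite -subset0 => x [/SK].
Qed.

(** Janiszewski's theorem is applied to the images of two paths, since it asks for bounded connected
    sets and components of the complement may be unbounded. *)
Lemma separatesU K1 K2 p z : closed K1 -> closed K2 -> K1 `&` K2 = set0 ->
  ~ K1 p -> ~ K2 p -> ~ K1 z -> ~ K2 z ->
  separates (K1 `|` K2) p z -> separates K1 p z \/ separates K2 p z.
Proof.
move=> cK1 cK2 K12 p1 p2 z1 z2 sep; apply: contrapT => /not_orP[n1 n2]; apply: sep.
have [g1 [c1 g10 g11 h1]] := not_separates_path cK1 n1.
have [g2 [c2 g20 g21 h2]] := not_separates_path cK2 n2.
have [a1 _ b1] := path_image_bounded c1; have [a2 _ b2] := path_image_bounded c2.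
apply: (janiszewski cK1 cK2 K12 a1 a2 b1 b2) => //.
- by rewrite -subset0 => _ [[t _ <-]]; exact: h1.
- by rewrite -subset0 => _ [[t _ <-]]; exact: h2.
- by exists 0 => //; rewrite /= in_itv /= lexx ler01.
- by exists 1 => //; rewrite /= in_itv /= lexx ler01.
- by exists 0 => //; rewrite /= in_itv /= lexx ler01.
- by exists 1 => //; rewrite /= in_itv /= lexx ler01.
Qed.

(* Zorn's lemma gives a minimal closed subset of K that still separates; it is
   connected by Janiszewski's theorem. *)
Lemma separates_connected K p z : compact K -> ~ K p -> ~ K z -> separates K p z ->
  exists K', [/\ K' `<=` K, K' !=set0, connected K', closed K' & separates K' p z].
Proof.
move=> cK Kp Kz sepK; have clK : closed K by apply: compact_closed => //; exact: norm_hausdorff.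
(* Minimal closed subsets of [K] are reached through maximal open sets [Q] to be removed, so that
   chains are handled by unions. *)
pose P (Q : set 'rV[R]_n) := open Q /\ separates (K `\` Q) p z.
have clKD Q : open Q -> closed (K `\` Q).
  by move=> oQ; apply: closedI => //; exact: open_closedC.
have [Q [[oQ sepQ] maxQ]] : exists Q, P Q /\ forall Q', Q `<` Q' -> ~ P Q'.
  apply: Zorn_bigcup => F FP totF.
  have oF : open (\bigcup_(X in F) X) by apply: bigcup_open => X /FP[].
  split => //; have [F0|/set0P[X0 FX0]] := eqVneq F set0.
    by rewrite F0 bigcup_set0 setD0.
  apply: contrapT => /(not_separates_path (clKD _ oF))[gam [cg g0 g1 gK]].
  have [cT kT _] := path_image_bounded cg; set S := gam @` _ in cT kT.
  have KS : compact (K `&` S) by apply: compact_closedI => //; apply: compact_closed => //; exact: norm_hausdorff.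
  have SF : K `&` S `<=` \bigcup_(X in F) X.
    by move=> x [Kx [t _ tx]]; apply: contrapT => nx; apply: (gK t); rewrite tx; split.
  (* The path meets [K] in a compact set covered by the chain, hence by a single member [X]; then
     removing [X] alone already destroys separation. *)
  move: KS; rewrite compact_cover => /(_ _ F id)[| |D' D'F SD'] //.
    by move=> X /FP[].
  have [X FX HX] : exists2 X, F X & forall Y, Y \in finmap.enum_fset D' -> Y `<=` X.
    have : forall Y, Y \in finmap.enum_fset D' -> F Y by move=> Y /D'F; rewrite inE.
    elim: (finmap.enum_fset D') => [_|Y s IH Fs]; first by exists X0.
    have [|X FX HX] := IH; first by move=> Z Zs; apply: Fs; rewrite inE Zs orbT.
    have FY : F Y by apply: Fs; rewrite inE eqxx.
    have [XY|YX] := totF _ _ FX FY.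
      exists Y => // Z; rewrite inE => /orP[/eqP->//|/HX ZX]; exact: subset_trans XY.
    by exists X => // Z; rewrite inE => /orP[/eqP->//|/HX].
  have [_ sepX] := FP X FX; apply: sepX.
  exists S => //; last by exists 1 => //; rewrite /= in_itv /= lexx ler01.
  split => //; first by exists 0 => //; rewrite /= in_itv /= lexx ler01.
  move=> x Sx [Kx]; apply.
  by have [Y D'Y Yx] := SD' x (conj Kx Sx); exact: HX Yx.
have clK' := clKD _ oQ.
exists (K `\` Q); split => //.
  apply/set0P/eqP => K0; apply: sepQ; rewrite K0 setC0.
  exists setT => //; split => //; apply: convex_connected; by move=> ? ? ? ? ? ?.
apply/connectedP => E [E0 KE [s1 s2]].
have clE b : closed (E b).
  move=> x clx; have : (K `\` Q) x by apply: clK'; apply: closureS clx; rewrite KE; case: b; [right|left].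
  rewrite KE => -[] Ex; case: b clx => // clx.
    by have : (E false `&` closure (E true)) x by []; rewrite s2.
  by have : (closure (E false) `&` E true) x by []; rewrite s1.
have E12 : E false `&` E true = set0.
  by rewrite -subset0 => x [h1 h2]; rewrite -s1; split => //; exact: subset_closure.
have EK b x : E b x -> (K `\` Q) x by rewrite KE; case: b; [right|left].
have [b sepE] : exists b, separates (E b) p z.
  have sep2 : separates (E false `|` E true) p z by rewrite -KE.
  have nE c q : ~ K q -> ~ E c q by move=> nKq /EK[].
  have [] := separatesU (clE false) (clE true) E12 (nE _ _ Kp) (nE _ _ Kp) (nE _ _ Kz) (nE _ _ Kz) sep2.
    by exists false.
  by exists true.
apply: (maxQ (Q `|` ~` E b)).
  split; first exact: subsetUl.
  have [x Ex] := E0 (~~ b) => BQ; have [_ nQx] := EK _ _ Ex; apply: nQx; apply: BQ.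
  right => Ebx; have : (E false `&` E true) x by case: (b) Ex Ebx.
  by rewrite E12.
split; first by apply: openU => //; exact: closed_openC.
rewrite (_ : K `\` _ = E b) //; apply/seteqP; split => x.
  by move=> [Kx /not_orP[_ /contrapT]].
move=> Ex; have [Kx nQx] := EK _ _ Ex; split => // -[//|]; exact.
Qed.

End Separation.

(** * Regular level sets *)

Section LevelSets.
Context {R : realType} {n : nat}.
Implicit Types (F : 'rV[R]_n -> R) (G : set 'rV[R]_n) (p : 'rV[R]_n).

Local Notation ee i := (@delta_mx R 1 n ord0 i).

Lemma diff_eq0_partials F p : differentiable F p ->
  'd F p = 0 :> ('rV[R]_n -> R) <-> (forall i, 'D_(ee i) F p = 0).
Proof.
move=> dF; split=> [d0 i|D0]; first by rewrite deriveE // d0.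
apply/funext => v; rewrite [v in LHS](row_sum_delta v) linear_sum big1 // => i _.
have Di : 'd F p (ee i) = 0 by rewrite -deriveE.
by rewrite linearZ /= Di scaler0.
Qed.

(** The slice of the ball [V] is convex, so all points of the level set in the domain of the chart
    lie in one component. A chart of the level set is therefore a chart of the component. *)
Lemma level_component_submanifold G F (a : R) q : (0 < n)%N -> open G -> class_C n G F ->
  regular_value G F a ->
  submanifold n n.-1 (connected_component (level_set G F a) q).
Proof.
move=> n0 oG Cn reg p Hp.
have CF : class_C n.-1.+1 G F by apply: class_C_le Cn; rewrite prednK.
have [Gp Fp] := connected_component_sub Hp.
pose g x := F x - a.
have Cg : class_C n.-1.+1 G g.
  exact: (class_CD oG CF (class_C_cst _ _ (- a))).
have [j dg] : exists j, 'D_(ee j) g p != 0.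
  apply: contrapT => no; apply: (reg p (conj Gp Fp)).
  have dF := class_C_differentiable oG CF Gp.
  apply/(diff_eq0_partials dF) => i.
  have dFi : derivable F p (ee i) by have [_ /(_ i)[h _]] := CF; exact: h.
  have <- : 'D_(ee i) g p = 'D_(ee i) F p.
    by rewrite /g deriveB ?derive_cst ?subr0 //; exact: derivable_cst.
  by apply/eqP; apply: contrapT => /negP ne; apply: no; exists i.
have [W [psi [r [r0 [oW Wp WG] Cpsi phiK psiK]]]] := straightening oG Cg Gp dg.
pose phi x := row_upd x j (g x).
pose V : set 'rV[R]_n := [set y | `|y - phi p| < r].
have {}phiK x : W x -> V (phi x) /\ psi (phi x) = x by exact: phiK.
have {}psiK y : V y -> W (psi y) /\ phi (psi y) = y by exact: psiK.
have oV : open V.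
  apply/open_normP => x xc; exists (r - `|x - phi p|); first by rewrite subr_gt0.
  move=> y yx /=; rewrite /V /= -(subrKA x); apply: le_lt_trans (ler_normD _ _) _.
  by rewrite -ltrBrDr.
have lt_last : (n.-1 < n)%N by rewrite prednK.
(* The slice [coord_subspace n.-1] is given by the vanishing of the last coordinate; [sw] exchanges
   it with coordinate [j]. *)
pose lst : 'I_n := Ordinal lt_last.
pose sw (x : 'rV[R]_n) : 'rV[R]_n := \row_i x ord0 (tperm j lst i).
have swK x : sw (sw x) = x by apply/rowP => i; rewrite !mxE tpermK.
pose V' := sw @^-1` V.
have csw : continuous sw.
  move=> x; apply: rV_continuous => i.
  rewrite (_ : (fun y => _) = fun y : 'rV[R]_n => y ord0 (tperm j lst i)).
    exact: coord_continuous.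
  by apply/funext => y; rewrite mxE.
have oV' : open V' by apply: open_comp => // x _; exact: csw.
have Csw m U : class_C_map m U sw.
  move=> i; rewrite (_ : (fun y => _) = fun y : 'rV[R]_n => y ord0 (tperm j lst i)).
    exact: class_C_coord.
  by apply/funext => y; rewrite mxE.
have Cphi : class_C_map n.-1.+1 W phi.
  move=> i; have [->|ij] := eqVneq i j.
    rewrite (_ : (fun y => _) = g); first exact: class_C_sub WG _.
    by apply/funext => y; rewrite mxE eqxx.
  rewrite (_ : (fun y => _) = fun y : 'rV[R]_n => y ord0 i); first exact: class_C_coord.
  by apply/funext => y; rewrite mxE (negPf ij).
have CW (U : set 'rV[R]_n) (f : 'rV[R]_n -> 'rV[R]_n) : class_C_map n.-1.+1 U f -> class_C_map n U f.
  by move=> h i; apply: class_C_le (h i); rewrite prednK.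
exists W, V', (sw \o phi), (psi \o sw); split => //.
  split; first split => //.
  - apply/seteqP; split=> [_ [x Wx <-]|y Vy].
      by rewrite /V' /= swK; case: (phiK x Wx).
    exists (psi (sw y)); first by case: (psiK _ Vy).
    by rewrite /=; have [_ ->] := psiK _ Vy; rewrite swK.
  - by move=> x; rewrite inE => Wx /=; rewrite swK; case: (phiK x Wx).
  have C1 : class_C_map n.-1.+1 W (sw \o phi).
    move=> i; rewrite (_ : (fun y => _) = fun y => phi y ord0 (tperm j lst i)).
      exact: Cphi.
    by apply/funext => y; rewrite mxE.
  have C2 : class_C_map n.-1.+1 V' (psi \o sw).
    move=> i; exact: (class_C_comp oV oV' (fun z Vz => Vz) (Cpsi i) (Csw _ _)).
  by split; apply: CW.
apply/seteqP; split=> [_ [x [Hx Wx] <-]|y [Vy hy]].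
  split; first by rewrite /V' /= swK; case: (phiK x Wx).
  move=> i ni; have -> : i = lst.
    by apply: val_inj => /=; apply/eqP; rewrite eqn_leq ni andbT -ltnS prednK.
  rewrite /= mxE tpermR mxE eqxx; have [_ Fx] := connected_component_sub Hx.
  by rewrite /g Fx subrr.
have [Wx phix] := psiK _ Vy.
exists (psi (sw y)); last by rewrite /= phix swK.
split => //.
apply: (connected_component_trans Hp).
pose Sl := V `&` [set z | z ord0 j = 0].
exists (psi @` Sl); last first.
  exists (sw y) => //; split => //=.
  by rewrite mxE tpermL; apply: hy.
split.
- exists (phi p); last by case: (phiK p Wp).
  split; first by case: (phiK p Wp).
  by rewrite /= mxE eqxx /g Fp subrr.
- move=> _ [z [Vz z0] <-]; have [Wz phiz] := psiK z Vz; split; first exact: WG.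
  have : g (psi z) = z ord0 j by rewrite -[in RHS]phiz mxE eqxx.
  by rewrite z0 /g => /eqP; rewrite subr_eq0 => /eqP.
- apply: connected_continuous_connected.
    apply: convex_connected => x z t [Vx x0] [Vz z0] t01; split; first exact: ball_convex.
    by rewrite /= !mxE x0 z0 subrr mulr0 addr0.
  apply: continuous_in_subspaceT => z; rewrite inE => -[Vz _].
  apply: rV_continuous => i; exact: class_C_continuous (Cpsi i) Vz.
Qed.

End LevelSets.

(** * Diameters and separation by small hypersurfaces *)

Section Diameter.
Context {R : realType} {n : nat}.
Implicit Types (x y z p : 'rV[R]_n) (H : set 'rV[R]_n).

Lemma edist_ge0 x y : 0 <= edist x y.
Proof. exact: sqrtr_ge0. Qed.

Lemma edistxx x : edist x x = 0.
Proof. by rewrite /edist big1 ?sqrtr0 // => i _; rewrite subrr expr0n. Qed.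

Lemma edist_le x y : edist x y <= n%:R * `|x - y|.
Proof.
have [n0|n0] := posnP n.
  rewrite /edist big1 ?sqrtr0 ?mulr_ge0 // => i _.
  by case: i => m h; exfalso; rewrite n0 in h.
have -> : n%:R * `|x - y| = Num.sqrt ((n%:R * `|x - y|) ^+ 2).
  by rewrite sqrtr_sqr ger0_norm // mulr_ge0.
rewrite /edist ler_sqrt ?sqr_ge0 //.
apply: (@le_trans _ _ (\sum_(i < n) `|x - y| ^+ 2)).
  apply: ler_sum => i _; rewrite -[leLHS]real_normK ?num_real //.
  by rewrite lerXn2r ?nnegrE //; have := coord_le_norm (x - y) i; rewrite !mxE.
rewrite sumr_const card_ord -[leLHS]mulr_natl exprMn ler_wpM2r ?sqr_ge0 //.
by rewrite -natrX ler_nat expnS expn1 leq_pmulr.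
Qed.

Lemma edist_gt0 x y : x <> y -> 0 < edist x y.
Proof.
move=> xy; rewrite lt_def edist_ge0 andbT; apply/eqP => e; apply: xy.
apply/rowP => i; apply/eqP; rewrite -subr_eq0 -sqrf_eq0.
have : \sum_(i < n) (x ord0 i - y ord0 i) ^+ 2 = 0.
  apply/eqP; rewrite eq_le; apply/andP; split; last by apply: sumr_ge0 => *; exact: sqr_ge0.
  by rewrite -sqrtr_eq0; apply/eqP.
by move=> /psumr_eq0P h; rewrite h // => *; exact: sqr_ge0.
Qed.

Lemma edist_line x v (s t : R) : edist (x + s *: v) (x + t *: v) = `|s - t| * edist x (x + v).
Proof.
rewrite /edist -sqrtr_sqr -sqrtrM ?sqr_ge0 // mulr_sumr; congr Num.sqrt.
by apply: eq_bigr => i _; rewrite !mxE; ring.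
Qed.

Lemma edist_has_ubound H : bounded_set H -> has_ubound [set edist x y | x in H & y in H].
Proof.
move=> [M [_ HM]]; exists (n%:R * (2 * (`|M| + 1))).
move=> _ [x Hx [y Hy <-]]; apply: le_trans (edist_le x y) _; rewrite ler_wpM2l //.
have b w : H w -> `|w| <= `|M| + 1.
  by move=> Hw; apply: HM => //; rewrite (le_lt_trans (ler_norm _)) // ltrDl.
by apply: le_trans (ler_normB _ _) _; have := b x Hx; have := b y Hy; lra.
Qed.

Lemma edist_le_diam H x y : bounded_set H -> H x -> H y -> edist x y <= diam H.
Proof.
move=> bH Hx Hy; apply: ub_le_sup; first exact: edist_has_ubound.
by exists x => //; exists y.
Qed.

Lemma diam_le H p (r : R) : H !=set0 -> (forall x, H x -> `|x - p| <= r) ->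
  diam H <= n%:R * (2 * r).
Proof.
move=> [x Hx] Hr; apply: ge_sup; first by exists (edist x x); exists x => //; exists x.
move=> _ [y Hy [z Hz <-]]; apply: le_trans (edist_le y z) _; rewrite ler_wpM2l //.
rewrite -(subrKA p); apply: le_trans (ler_normD _ _) _; rewrite (distrC p z).
by have := Hr y Hy; have := Hr z Hz; lra.
Qed.

(** The outside of a ball of the sup norm is a union of open half-spaces, one for each axis and
    sign. Two of them with different axes meet; two with the same axis are joined through a third
    one, whose axis exists because n >= 2. *)
Lemma outside_connected p (r : R) u v : (2 <= n)%N -> 0 <= r ->
  r < `|u - p| -> r < `|v - p| -> connected_component [set x | r < `|x - p|] u v.
Proof.
move=> n2 r0; set X := [set x | _].
pose hs (i : 'I_n) (s : R) : set 'rV[R]_n := [set x | r < s * (x ord0 i - p ord0 i)].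
have hsX i s : `|s| = 1 -> hs i s `<=` X.
  move=> s1 x hx; apply: lt_le_trans hx _; apply: le_trans (ler_norm _) _.
  by rewrite normrM s1 mul1r; have := coord_le_norm (x - p) i; rewrite !mxE.
have hs_cvx i s : is_convex (hs i s).
  move=> x y t hx hy /andP[t0 t1]; rewrite /hs /= !mxE.
  have -> : s * (x ord0 i + t * (y ord0 i - x ord0 i) - p ord0 i) =
    (1 - t) * (s * (x ord0 i - p ord0 i)) + t * (s * (y ord0 i - p ord0 i)) by ring.
  move: hx hy; rewrite /hs /=.
  set A := s * _; set B := s * _ => hx hy.
  have [->|tn0] := eqVneq t 0; first by rewrite subr0 mul1r mul0r addr0.
  have t0' : 0 < t by rewrite lt_def tn0.
  have : t * r < t * B by rewrite ltr_pM2l.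
  have : (1 - t) * r <= (1 - t) * A by rewrite ler_wpM2l ?subr_ge0 // ltW.
  lra.
have X_hs x : X x -> exists i s, `|s| = 1 /\ hs i s x.
  move=> Xx; apply: contrapT => no.
  suff : `|x - p| <= r by rewrite leNgt; move: Xx; rewrite /X /= => ->.
  apply: norm_le_coord => // i; rewrite !mxE leNgt; apply/negP => h; apply: no.
  exists i; have [h0|h0] := leP 0 (x ord0 i - p ord0 i).
    by exists 1; rewrite normr1 /hs /= mul1r; move: h; rewrite ger0_norm.
  by exists (-1); rewrite normrN1 /hs /= mulN1r; move: h; rewrite ltr0_norm.
have comp i s x y : `|s| = 1 -> hs i s x -> hs i s y -> connected_component X x y.
  move=> s1 hx hy; exists (hs i s) => //; split => //; first exact: hsX.
  exact/convex_connected/hs_cvx.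
have diff i j s s' x y : i != j -> `|s| = 1 -> `|s'| = 1 -> hs i s x -> hs j s' y ->
    connected_component X x y.
  move=> ij s1 s1' hx hy.
  pose w : 'rV[R]_n := \row_l (p ord0 l + if l == i then s * (r + 1) else
    if l == j then s' * (r + 1) else 0).
  have sq (a : R) : `|a| = 1 -> a * a = 1.
    by move=> a1; rewrite -expr2 -real_normK ?num_real // a1 expr1n.
  apply: (@connected_component_trans _ X w).
    apply: (comp i s) => //; rewrite /hs /= mxE eqxx addrAC subrr add0r mulrA sq // mul1r.
    by rewrite ltrDl.
  apply: (comp j s') => //; rewrite /hs /= mxE eq_sym (negPf ij) eqxx.
  by rewrite addrAC subrr add0r mulrA sq // mul1r ltrDl.
move=> /X_hs[i [s [s1 hu]]] /X_hs[j [s' [s1' hv]]].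
have [ij|ij] := eqVneq i j; last exact: diff hu hv.
have [l li] : exists l : 'I_n, l != i.
  have [/eqP i0|i0] := boolP (i == Ordinal (ltnW n2) :> 'I_n).
    by exists (Ordinal n2); rewrite i0.
  by exists (Ordinal (ltnW n2)); rewrite eq_sym.
pose w : 'rV[R]_n := p + const_mx (r + 1).
have hw : hs l 1 w by rewrite /hs /= !mxE addrAC subrr add0r mul1r ltrDl.
apply: (@connected_component_trans _ X w).
  by apply: (diff i l s 1) => //; rewrite ?normr1 // eq_sym.
by apply: (diff l j 1 s') => //; rewrite ?normr1 // -ij.
Qed.

End Diameter.

(** * Necessity: small hypersurfaces around a point isolate it in its level set *)

Section Necessity.
Context {R : realType} {n : nat}.

Lemma L_function_quasi_isolated r (G : set 'rV[R]_n) F x0 : G x0 ->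
  L_function r G F x0 -> quasi_isolated G F x0.
Proof.
move=> Gx0 [_ [a [H [_ _ HH dH]]]]; exists x0 => //; apply/seteqP; split.
  by move=> _ ->; exact: connected_component_refl.
move=> z Cz; apply: contrapT => zx0.
have d0 : 0 < edist x0 z by apply: edist_gt0 => e; apply: zx0.
have [i di] : exists i, diam (H i) < edist x0 z.
  have /cvgrPdist_lt /(_ _ d0)[i _ hi] := dH; exists i.
  by apply: le_lt_trans (hi i (leqnn i)); rewrite sub0r normrN ler_norm.
have [[h Lh Hh] [cH kH _] [Hx0 Hb]] := HH i.
have clH : closed (H i) by apply: compact_closed => //; exact: norm_hausdorff.
set C := connected_component _ _ in Cz.
have cC : connected C by exact: component_connected.
have Cx0 : C x0 by exact: connected_component_refl.
(* A common point would force [a i = F x0]; then [H i] and [C] would be the same component and [x0]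
   would lie on [H i]. *)
have CH : C `&` H i = set0.
  rewrite -subset0 => w [Cw Hw]; apply: Hx0; rewrite Hh.
  have [_ Fw] := connected_component_sub Cw.
  have aE : a i = F x0.
    by move: (Hw); rewrite Hh => /connected_component_sub[_ <-].
  rewrite aE; move: Hw; rewrite Hh aE => Hw; apply: (connected_component_trans Hw).
  exact: connected_component_sym.
have [gam [cg g0 g1 gH]] := connected_path clH cC CH Cx0 Cz.
have [t _] := Hb z gam di (continuous_subspaceT cg) g0 g1; exact: gH.
Qed.

End Necessity.

(** * Sufficiency: symmetric regular values and trapped level components *)

Section RegularValues.
Context {R : realType} {n : nat}.
Implicit Types (F : 'rV[R]_n -> R) (G : set 'rV[R]_n).

Lemma not_critical_regular G F (a : R) : (0 < n)%N -> open G -> class_C n G F ->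
  ~ (F @` critical_set G F) a -> regular_value G F a.
Proof.
move=> n0 oG Cn na x [Gx Fx] d0; apply: na; exists x => //; split => //.
apply/diff_eq0_partials => //.
have CF : class_C n.-1.+1 G F by apply: class_C_le Cn; rewrite prednK.
exact: class_C_differentiable CF Gx.
Qed.

(** A value [v] is critical for the reflection [F'] exactly when 2c - v is critical for [F]. Sard's
    theorem for both functions leaves, in an interval of positive length, a [v] critical for
    neither, and t is v - c. *)
Lemma symmetric_regular_values G F (c d : R) : (0 < n)%N -> open G -> class_C n G F ->
  0 < d -> exists t, [/\ 0 < t < d, regular_value G F (c + t) & regular_value G F (c - t)].
Proof.
move=> n0 oG Cn d0; pose F' x := 2 * c - F x.
have CF' : class_C n G F'.
  by apply: (class_CD oG (class_C_cst _ _ _) (class_CN oG Cn)).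
have nul : lebesgue_measure.-negligible
    ((F @` critical_set G F) `|` (F' @` critical_set G F') : set R).
  by apply: negligibleU; exact: sard.
have [v [vI nv]] : exists v, (v \in `]c, (c + d)[) /\
    ~ ((F @` critical_set G F) `|` (F' @` critical_set G F')) v.
  apply: contrapT => no.
  have sub : `]c, (c + d)[%classic `<=` (F @` critical_set G F) `|` (F' @` critical_set G F').
    by move=> v vI; apply: contrapT => nv; apply: no; exists v.
  have [X [mX X0 NX]] := nul.
  have : (lebesgue_measure (`]c, (c + d)[%classic : set R)%R <= lebesgue_measure X)%E.
    by apply: le_measure; rewrite ?inE //; exact: subset_trans NX.
  rewrite X0 lebesgue_measure_itv /= lte_fin ltrDl d0 -EFinB addrAC subrr add0r.
  by rewrite lee_fin leNgt d0.
move: vI; rewrite in_itv /= => /andP[cv vd].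
move: nv => /not_orP[nv nv'].
exists (v - c); split; first by apply/andP; split; lra.
  by rewrite addrC subrK; exact: not_critical_regular.
have -> : c - (v - c) = 2 * c - v by ring.
have CF : class_C n.-1.+1 G F by apply: class_C_le Cn; rewrite prednK.
apply: not_critical_regular => // -[x [Gx Dx] Fx]; apply: nv'.
exists x; last by rewrite /F' Fx; ring.
split => // i; rewrite /F' deriveB.
- by rewrite derive_cst Dx subrr.
- exact: derivable_cst.
- by have [_ /(_ i)[h _]] := CF; exact: h.
Qed.

End RegularValues.

Section Sufficiency.
Context {R : realType} {n : nat}.
Variables (G : set 'rV[R]_n) (F : 'rV[R]_n -> R) (x0 : 'rV[R]_n).
Hypotheses (n2 : (2 <= n)%N) (oG : open G) (CF : class_C n G F) (Gx0 : G x0).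
Implicit Types (S A : set 'rV[R]_n).

Let c := F x0.

Let closed_preimage_in S (C : set R) : closed S -> S `<=` G -> closed C ->
  closed (S `&` F @^-1` C).
Proof.
move=> cS SG cC x clx.
have Sx : S x by apply: cS; apply: closureS clx => ? [].
split => //; apply: cC => B FB.
have cF := class_C_continuous CF (SG x Sx).
by have [y [[_ Cy] By]] := clx _ (cF _ FB); exists (F y).
Qed.

Let closed_value S (b : R) : closed S -> S `<=` G -> closed (S `&` F @^-1` [set b]).
Proof.
by move=> cS SG; apply: closed_preimage_in.
Qed.

Let closed_band S (t : R) : closed S -> S `<=` G -> closed (S `&` [set x | `|F x - c| <= t]).
Proof.
move=> cS SG.
rewrite (_ : [set x | _] = F @^-1` `[c - t, c + t]).
  by apply: closed_preimage_in => //; exact: interval_closed.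
by apply/seteqP; split=> x; rewrite /= in_itv /= ler_distl.
Qed.

Section Trap.
Variables (r d0 : R).
Let D : set 'rV[R]_n := [set x | `|x - x0| <= r].
Let B : set 'rV[R]_n := [set x | `|x - x0| < r].
Let E := connected_component (D `&` [set x | `|F x - c| <= d0]) x0.
Hypotheses (r0 : 0 < r) (DG : D `<=` G) (d00 : 0 < d0) (EB : E `<=` B).

(** Since [E] avoids the sphere of radius [r], the closure of [W t] stays inside [B] for t <= d0,
    and its boundary is due to [F] alone. *)
Let W t := connected_component (B `&` [set x | `|F x - c| < t]) x0.

Let BD : B `<=` D. Proof. by move=> x /ltW. Qed.

Let band_open t : open (B `&` [set x | `|F x - c| < t]).
Proof.
apply/open_normP => x [Bx Fx].
have [e1 e10 He1] := (continuous_normP _ _).1 (class_C_continuous CF (DG (BD Bx)))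
  (t - `|F x - c|) ltac:(by rewrite subr_gt0).
exists (Num.min e1 (r - `|x - x0|)); first by rewrite lt_min e10 subr_gt0.
move=> y; rewrite lt_min => /andP[/He1 y1 y2]; split => /=.
  by rewrite /B /= -(subrKA x); apply: le_lt_trans (ler_normD _ _) _; rewrite -ltrBrDr.
by rewrite -(subrKA (F x)); apply: le_lt_trans (ler_normD _ _) _; rewrite -ltrBrDr.
Qed.

Let W_open t : open (W t). Proof. exact: component_open. Qed.

Let Wx0 t : 0 < t -> W t x0.
Proof.
by move=> t0; apply: connected_component_refl; split; [rewrite /B|rewrite /c]; rewrite /= subrr normr0.
Qed.

Let cl_W_E t : 0 < t -> t <= d0 -> closure (W t) `<=` E.
Proof.
move=> t0 td; have clE : closed E.
  by apply: component_closed; apply: closed_band => //; exact: closed_norm_ball.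
suff WE : W t `<=` E by move=> x /(closureS WE); exact: clE.
apply: connected_component_max; [exact: Wx0| |exact: component_connected].
move=> x /connected_component_sub[/BD Dx Fx]; split => //=.
by apply: le_trans td; exact: ltW.
Qed.

Let cl_W_band t x : 0 < t -> t <= d0 -> closure (W t) x -> `|F x - c| <= t.
Proof.
move=> t0 td clx; have clB : closed (closure (W t) `&` [set x | `|F x - c| <= t]).
  apply: closed_band; first exact: closed_closure.
  by move=> y /(cl_W_E t0 td)/EB/BD/DG.
suff : (closure (W t) `&` [set x | `|F x - c| <= t]) x by case.
apply: clB; apply: closureS clx => y Wy; split; first exact: subset_closure.
by have [_ /ltW] := connected_component_sub Wy.
Qed.

(** With [cl_W_band] this puts the boundary of [W t] on the levels c + t and c - t: a limit point in
    the open band has a ball in the band, which joins it to [W t]. *)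
Let cl_W_inside t x : 0 < t -> t <= d0 -> closure (W t) x -> `|F x - c| < t -> W t x.
Proof.
move=> t0 td clx Fx.
have Bx : B x by apply/EB/(cl_W_E t0 td).
have [e e0 He] := (open_normP _).1 (@band_open t) x (conj Bx Fx).
have [|y [Wy yx]] := clx [set y | `|y - x| < e].
  by apply/nbhs_ballP; exists e => //= y; rewrite -ball_normE /= distrC.
apply: (connected_component_trans Wy).
exists [set z | `|z - x| < e] => //; last by rewrite /= subrr normr0.
by split => //; exact/convex_connected/ball_convex.
Qed.

Let W_sub t t' : t <= t' -> 0 < t -> W t `<=` W t'.
Proof.
move=> tt' t0; apply: connected_component_max; [exact: Wx0| |exact: component_connected].
by move=> x /connected_component_sub[Bx Fx]; split => //=; exact: lt_le_trans tt'.
Qed.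

(** Enlarging the connected separating set [K'] to a full level component [H] might lose the
    confinement to [B]. It does not, because |F - c| = t < d0 on [H] prevents it from crossing the
    boundary of [W d0]. *)
Lemma trapped_hypersurface t z : 0 < t < d0 -> r < `|z - x0| ->
  regular_value G F (c + t) -> regular_value G F (c - t) ->
  exists b H, [/\ `|b - c| = t /\ regular_value G F b,
    is_component (level_set G F b) H, closed_hypersurface n H, H `<=` B & separates H x0 z].
Proof.
move=> /andP[t0 td] zr reg1 reg2; have td' := ltW td.
pose K b := closure (W t) `&` F @^-1` [set b].
have clWG : closure (W t) `<=` G by move=> y /(cl_W_E t0 td')/EB/BD/DG.
have clK b : closed (K b).
  by apply: closed_value => //; exact: closed_closure.
have KB b : K b `<=` B by move=> y [/(cl_W_E t0 td')/EB].
have nKz b : ~ K b z by move=> /KB; rewrite /B /= ltNge ltW.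
have nKx b : b != c -> ~ K b x0 by move=> /eqP bc [_ /= e]; apply: bc; rewrite -e.
have p_c : c + t != c by rewrite -subr_eq0 addrAC subrr add0r gt_eqF.
have m_c : c - t != c by rewrite -subr_eq0 addrAC subrr add0r oppr_eq0 gt_eqF.
have K12 : K (c + t) `&` K (c - t) = set0.
  rewrite -subset0 => y [[_ /= e1] [_ /= e2]]; move: e1; rewrite e2 => e3; lra.
have sepK : separates (K (c + t) `|` K (c - t)) x0 z.
  move=> [S [Sx0 SK cS] Sz].
  have SW : S `<=` W t.
    apply: connected_open_sub => //.
      move=> y [Sy cly]; have := cl_W_band t0 td' cly; rewrite le_eqVlt => /orP[/eqP Fy|].
        exfalso; apply: (SK y Sy); have [h|h] := leP 0 (F y - c).
          by left; split => //=; rewrite -Fy ger0_norm // addrC subrK.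
        by right; split => //=; rewrite -Fy ltr0_norm // opprK addrC subrK.
      exact: cl_W_inside.
    by exists x0; split => //; exact: Wx0.
  have [Bz _] := connected_component_sub (SW z Sz).
  by move: Bz; rewrite /B /= ltNge ltW.
have [b [bt regb bc sepb]] : exists b, [/\ `|b - c| = t, regular_value G F b, b != c & separates (K b) x0 z].
  have [h|h] := separatesU (clK _) (clK _) K12 (nKx _ p_c) (nKx _ m_c) (nKz _) (nKz _) sepK.
    by exists (c + t); split => //; rewrite addrAC subrr add0r gtr0_norm.
  by exists (c - t); split => //; rewrite addrAC subrr add0r normrN gtr0_norm.
have cptK : compact (K b).
  apply: subclosed_compact (clK b) (@norm_ball_compact R n x0 r) _.
  by move=> y /KB/BD.
have [K' [K'K [q K'q] conK' _ sepK']] := separates_connected cptK (nKx _ bc) (nKz b) sepb.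
pose H := connected_component (level_set G F b) q.
have Lq : level_set G F b q by have [/clWG ? ?] := K'K q K'q.
have Hq : H q by exact: connected_component_refl.
have K'H : K' `<=` H.
  apply: connected_component_max => // y /K'K[/clWG ? ?]; by split.
have HW : H `<=` W d0.
  apply: connected_open_sub; [exact: component_connected|exact: W_open| |].
    move=> y [Hy cly]; apply: cl_W_inside => //.
    by have [_ /= ->] := connected_component_sub Hy; rewrite bt.
  exists q; split => //; apply: cl_W_inside => //.
    by have [clq _] := K'K q K'q; apply: closureS clq; exact: W_sub.
  by have [_ /= ->] := Lq; rewrite bt.
have HB : H `<=` B by move=> y /HW/connected_component_sub[].
(* The component is closed in a level set that is closed only relative to [G]; the closure of [H]
   stays in [E], hence in [G]. *)
have clH : closed H.
  have clHE : closure H `<=` E by move=> y /(closureS HW)/cl_W_E; apply.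
  have clHL : closure H `<=` level_set G F b.
    move=> y cly; split; first exact/DG/BD/EB/clHE.
    have cl1 : closed (closure H `&` F @^-1` [set b]).
      apply: closed_value; first exact: closed_closure.
      by move=> w /clHE/EB/BD/DG.
    suff : (closure H `&` F @^-1` [set b]) y by case.
    apply: cl1; apply: closureS cly => w Hw; split; first exact: subset_closure.
    by have [] := connected_component_sub Hw.
  move=> y cly; suff : closure H `<=` H by apply.
  apply: connected_component_max => //; first exact: subset_closure.
  exact/connected_closure/component_connected.
exists b, H; split => //.
- by exists q.
- split; first exact: component_connected.
    by apply: subclosed_compact clH (@norm_ball_compact R n x0 r) _ => y /HB/BD.
  by apply: level_component_submanifold => //; exact: ltnW.
- move=> [S [Sx0 SH cS] Sz]; apply: sepK'; exists S => //; split => //.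
  by move=> y Sy /K'H; exact: SH.
Qed.

End Trap.

(** If a path reached [x], farther from [x0] than the diameter, without meeting [H], then [x] would
    lie in the inside component. The ray from [x] away from [x0] and the opposite ray from [x0] both
    leave that component, so they meet [H] at two points at least as far apart as [x0] and [x]. *)
Lemma separates_bounds (r : R) z H : 0 < r -> H `<=` [set x | `|x - x0| < r] ->
  closed_hypersurface n H -> ~ H x0 -> r < `|z - x0| -> separates H x0 z -> bounds H x0.
Proof.
move=> r0 HB [_ kH _] Hx0 zr sepH; split => // x gam dx cg g0 g1.
apply: contrapT => no.
have bH : bounded_set H by exact: compact_bounded.
have outH : [set x | r < `|x - x0|] `<=` ~` H.
  by move=> y /= yr /HB /=; rewrite ltNge ltW.
have far u : r < `|u - x0| -> ~ connected_component (~` H) x0 u.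
  move=> ur Cu; apply: sepH; apply: (connected_component_trans Cu).
  have [S [Su SX cS] Sz] := outside_connected n2 (ltW r0) ur zr.
  by exists S => //; split => //; exact: subset_trans outH.
have Cx : connected_component (~` H) x0 x.
  exists (gam @` `[0, 1]); last by exists 1 => //; rewrite /= in_itv /= lexx ler01.
  split; first by exists 0 => //; rewrite /= in_itv /= lexx ler01.
    by move=> _ [t t01 <-] Ht; apply: no; exists t.
  by apply: connected_continuous_connected => //; exact: segment_connected.
(* For [x = x0] the diameter would be negative, whereas [H] is nonempty: the empty set separates
   nothing. *)
have xx0 : x <> x0.
  move=> e; rewrite e edistxx in dx.
  have [h Hh] : H !=set0.
    apply/set0P/eqP => H0; apply: sepH; rewrite H0 setC0; exists setT => //; split => //.
    by apply: convex_connected => ? ? ? ? ? ?.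
  by have := edist_le_diam bH Hh Hh; rewrite edistxx leNgt dx.
pose v := x - x0.
have v0 : 0 < `|v| by rewrite normr_gt0 subr_eq0; exact/eqP.
have ray_hits (y : 'rV[R]_n) (s : R) : connected_component (~` H) x0 y ->
    (exists2 t, 0 <= t & r < `|y + t *: (s *: v) - x0|) ->
    exists2 t, 0 <= t & H (y + t *: (s *: v)).
  move=> Cy [t t0 ht]; apply: contrapT => nh; apply: (far _ ht).
  apply: (connected_component_trans Cy).
  exists ((fun t : R => y + t *: (s *: v)) @` [set t | 0 <= t]); last by exists t.
  split; first by exists 0; rewrite /= ?lexx // scale0r addr0.
    by move=> _ [u u0 <-] Hu; apply: nh; exists u.
  apply: convex_connected => _ _ w [u u0 <-] [u' u'0 <-] /andP[w0 w1].
  exists ((1 - w) * u + w * u').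
    by rewrite /= addr_ge0 // mulr_ge0 // subr_ge0.
  by apply/rowP => i; rewrite !mxE; ring.
(* At parameter [T] the displacement along [v] has norm r + 1, which takes both rays out of the
   ball. *)
pose T := (r + 1) / `|v|.
have T0 : 0 <= T by rewrite divr_ge0 // addr_ge0 // ltW.
have Tv : T * `|v| = r + 1 by rewrite divfK // gt_eqF.
have [t1 t10 h1] : exists2 t, 0 <= t & H (x + t *: (1 *: v)).
  apply: ray_hits => //; exists T => //.
  have -> : x + T *: (1 *: v) - x0 = (1 + T) *: v.
    by rewrite scale1r scalerDl scale1r /v; apply/rowP => i; rewrite !mxE; ring.
  rewrite normrZ ger0_norm ?addr_ge0 // mulrDl Tv mul1r; lra.
have [t2 t20 h2] : exists2 t, 0 <= t & H (x0 + t *: ((-1) *: v)).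
  apply: ray_hits; first exact: connected_component_refl.
  exists T => //.
  have -> : x0 + T *: ((-1) *: v) - x0 = (- T) *: v.
    by rewrite scaleN1r scalerN scaleNr addrAC subrr add0r.
  rewrite normrZ normrN ger0_norm // Tv; lra.
have := edist_le_diam bH h1 h2.
have -> : x + t1 *: (1 *: v) = x0 + (1 + t1) *: v.
  by rewrite /v; apply/rowP => i; rewrite !mxE; ring.
have -> : x0 + t2 *: ((-1) *: v) = x0 + (- t2) *: v.
  by apply/rowP => i; rewrite !mxE; ring.
have E : x0 + v = x by rewrite addrC subrK.
rewrite edist_line E leNgt => /negP; apply.
apply: lt_le_trans dx _; rewrite -[leLHS]mul1r ler_wpM2r ?edist_ge0 //.
by rewrite opprK ger0_norm; lra.
Qed.

Lemma small_hypersurface (e : R) : quasi_isolated G F x0 -> 0 < e ->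
  exists b H, [/\ `|b - c| < e /\ regular_value G F b,
    is_component (level_set G F b) H, closed_hypersurface n H, bounds H x0 & 0 <= diam H <= e].
Proof.
move=> [x1 Lx1 compE] e0; have n0 : (0 < n)%N by exact: ltnW.
have [r1 r10 Hr1] := (open_normP G).1 oG x0 Gx0.
(* The first bound keeps the closed ball inside [G]; the second makes the Euclidean diameter of its
   nonempty subsets at most [e], by [diam_le]. *)
pose r := Num.min (r1 / 2) (e / (n%:R * 2)).
have nR0 : 0 < n%:R * 2 :> R by rewrite mulr_gt0 // ltr0n.
have r0 : 0 < r by rewrite lt_min !divr_gt0.
pose D : set 'rV[R]_n := [set x | `|x - x0| <= r].
have DG : D `<=` G.
  move=> x xD; apply: Hr1; apply: le_lt_trans xD _.
  by apply: (@le_lt_trans _ _ (r1 / 2)); [rewrite ge_min lexx|lra].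
have clD : closed D by exact: closed_norm_ball.
pose E (k : nat) := connected_component (D `&` [set x | `|F x - c| <= k.+1%:R^-1]) x0.
have Dx0 (t : R) : 0 <= t -> (D `&` [set x | `|F x - c| <= t]) x0.
  by move=> t0; split; [rewrite /D|rewrite /c]; rewrite /= subrr normr0 // ltW.
have clE k : closed (E k) by apply: component_closed; exact: closed_band.
have inv0 k : 0 < k.+1%:R^-1 :> R by rewrite invr_gt0.
have Ex0 k : E k x0 by apply/connected_component_refl/Dx0/ltW.
have ED k : E k `<=` D by move=> x /connected_component_sub[].
have cE0 k : compact (E k) by apply: subclosed_compact (clE k) (@norm_ball_compact R n x0 r) _; exact: ED.
have decE k : E k.+1 `<=` E k.
  apply: connected_component_max; [exact: Ex0| |exact: component_connected].
  move=> x /connected_component_sub[Dx Fx]; split => //=; apply: le_trans Fx _.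
  by rewrite lef_pV2 ?posrE // ler_nat.
(* Quasi-isolation provides the component of some base point [x1]; it contains [x0], so it is the
   component of [x0]. *)
have x1E : connected_component (level_set G F c) x0 = [set x0].
  have : connected_component (level_set G F (F x0)) x1 x0 by rewrite -compE.
  by move=> /same_connected_component <-; rewrite -compE.
have capE x : (forall k, E k x) -> x = x0.
  move=> Ex; suff : [set x0] x by [].
  rewrite -x1E; exists (\bigcap_k E k) => //; split.
  - by move=> k _; exact: Ex0.
  - move=> y Ey; split; first by apply/DG/(ED 0%N); exact: Ey.
    apply/eqP; rewrite -subr_eq0 -normr_eq0; apply/eqP/le_anti; rewrite normr_ge0 andbT.
    apply/ler_addgt0Pr => eps eps0; rewrite add0r.
    have [k ke] : exists k : nat, k.+1%:R^-1 < eps.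
      exists (Num.bound eps^-1); rewrite invf_plt ?posrE //.
      apply: (@lt_trans _ _ (Num.bound eps^-1)%:R); last by rewrite ltr_nat.
      by apply: archi_boundP; rewrite invr_ge0 ltW.
    have [_ /= h] := connected_component_sub (Ey k I).
    exact: le_trans h (ltW ke).
  - apply: nested_connected => // k; exact: component_connected.
(* By compactness the nested components avoid the sphere from some [k] on, which is what the trap
   requires. *)
have [k EkB] : exists k, E k `<=` [set x | `|x - x0| < r].
  apply: contrapT => no.
  have clO : closed [set x : 'rV[R]_n | r <= `|x - x0|].
    rewrite (_ : [set x | _] = ~` [set x | `|x - x0| < r]).
      apply: open_closedC; apply/open_normP => x xr; exists (r - `|x - x0|).
        by rewrite subr_gt0.
      move=> y yx /=; rewrite -(subrKA x); apply: le_lt_trans (ler_normD _ _) _.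
      by rewrite -ltrBrDr.
    by apply/seteqP; split=> x /=; rewrite leNgt => /negP.
  have [x Ex] : \bigcap_k (E k `&` [set x | r <= `|x - x0|]) !=set0.
    apply: nested_compact_nonempty.
    - by move=> k; apply: closedI.
    - by apply: compact_closedI.
    - by move=> k x [/decE].
    - move=> k; apply: contrapT => nk; apply: no; exists k => x Ex /=.
      by rewrite ltNge; apply/negP => h; apply: nk; exists x.
  have xx0 : x = x0 by apply: capE => k; have [] := Ex k I.
  by have [_ /=] := Ex 0%N I; rewrite xx0 subrr normr0 leNgt r0.
(* Below 1/(k+1) the value t fits the trap; below [e] it keeps the level within [e] of [c]. *)
pose d := Num.min k.+1%:R^-1 e.
have d0 : 0 < d by rewrite lt_min inv0.
have [t [/andP[t0 td] reg1 reg2]] := symmetric_regular_values c n0 oG CF d0.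
move: td; rewrite lt_min => /andP[tk te].
pose z : 'rV[R]_n := x0 + const_mx (r + 1).
have zr : r < `|z - x0|.
  apply: (@lt_le_trans _ _ (r + 1)); first by rewrite ltrDl.
  have := coord_le_norm (z - x0) (Ordinal n0); rewrite !mxE addrAC subrr add0r.
  by apply: le_trans; exact: ler_norm.
have t0k : 0 < t < k.+1%:R^-1 by rewrite t0.
have [b [H [[bt regb] compH hypH HB sepH]]] :=
  trapped_hypersurface r0 DG (inv0 k) EkB t0k zr reg1 reg2.
have Hx0 : ~ H x0.
  move: compH => [q _ ->] /connected_component_sub[_ /= Fb].
  by move: bt; rewrite -Fb subrr normr0 => t00; rewrite -t00 ltxx in t0.
have Hn0 : H !=set0.
  by move: compH => [q Lq ->]; exists q; exact: connected_component_refl.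
exists b, H; split => //; first by rewrite bt.
  exact: separates_bounds r0 HB hypH Hx0 zr sepH.
have [h Hh] := Hn0; have [_ kH _] := hypH.
apply/andP; split.
  by rewrite -(edistxx h); apply: edist_le_diam => //; exact: compact_bounded.
apply: le_trans (diam_le Hn0 (fun x Hx => ltW (HB x Hx))) _.
rewrite mulrA -ler_pdivlMl // mulrC.
by rewrite /r ge_min lexx orbT.
Qed.

Lemma quasi_isolated_L_function : quasi_isolated G F x0 -> L_function n G F x0.
Proof.
move=> qi; split => //.
have inv0 k : 0 < k.+1%:R^-1 :> R by rewrite invr_gt0.
have /choice[aH HaH] : forall k : nat, exists aH : R * set 'rV[R]_n,
    [/\ `|aH.1 - c| < k.+1%:R^-1 /\ regular_value G F aH.1,
    is_component (level_set G F aH.1) aH.2, closed_hypersurface n aH.2,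
    bounds aH.2 x0 & 0 <= diam aH.2 <= k.+1%:R^-1].
  by move=> k; have [b [H h]] := small_hypersurface qi (inv0 k); exists (b, H).
exists (fun k => (aH k).1), (fun k => (aH k).2); split.
- by move=> k; have [[_ ?]] := HaH k.
- apply/cvgrPdist_lt => _/posnumP[e]; near=> k.
  have [[h _] _ _ _ _] := HaH k; rewrite distrC; apply: lt_trans h _.
  by near: k; exact: near_infty_natSinv_lt.
- by move=> k; have [_ ? ? ? _] := HaH k.
- apply/cvgrPdist_lt => _/posnumP[e]; near=> k.
  have [_ _ _ _ /andP[h1 h2]] := HaH k.
  rewrite sub0r normrN ger0_norm //; apply: le_lt_trans h2 _.
  by near: k; exact: near_infty_natSinv_lt.
Unshelve. all: by end_near. Qed.

End Sufficiency.

Theorem theorem4p1 (R : realType) (n : nat) (G : set 'rV[R]_n)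
    (F : 'rV[R]_n -> R) (x0 : 'rV[R]_n) :
  (2 <= n)%N -> is_domain G -> class_C n G F -> G x0 ->
  L_function n G F x0 <-> quasi_isolated G F x0.
Proof.
move=> n2 [_ oG _] CF Gx0; split; first exact: L_function_quasi_isolated.
exact: quasi_isolated_L_function.
Qed.
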